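(* Let $\Phi\subset\mathbb{R}^3$ be a ruled $C^3$-surface, free of torsal rulings, which is relatively normalized by ${}^{(\alpha)}\bar y$ with $\alpha\in\mathbb{R}\setminus\{1/4\}$. For the Tchebychev vector field ${}^{(\alpha)}\bar T$ the following properties are valid: (i) $\operatorname{div}{}^{(0)}\bar T\equiv0$ when $\Phi$ is a right conoid. (ii) $\operatorname{div}{}^{(\alpha)}\bar T\equiv0$ (for $\alpha\in\mathbb{R}\setminus\{0,1/4\}$) when $\Phi$ lies on a right helicoid. (iii) $\operatorname{rot}{}^{(\alpha)}\bar T\equiv0$ (for $\alpha\in\mathbb{R}\setminus\{1/4\}$) when $\Phi$ is an Edlinger surface with congruent osculating hyperboloids.
   Context: Ruled surfaces. Let $I\subset\mathbb{R}$ be an open interval and $U=I\times\mathbb{R}$. A ruled surface $\Phi$ free of torsal rulings is parametrized over $U$ by the (injective) immersion $\bar x(u,v)=\bar s(u)+v\,\bar e(u)$ with $|\bar e|=|\bar e'|=1$ and $\langle\bar s',\bar e'\rangle=0$ on $I$ (so $\bar s$ is the line of striction, $u$ is arc length of the spherical curve $\bar e$); a prime denotes $d/du$. For a $C^3$-surface $\bar s,\bar e$ are of class $C^3$. The moving frame is $\bar e$, $\bar n=\bar e'$, $\bar z=\bar e\times\bar n$. The fundamental invariants are: conical curvature $\kappa=\det(\bar e,\bar e',\bar e'')$, parameter of distribution $\delta=\det(\bar s',\bar e,\bar e')$, and $\lambda$, defined by $\bar s'=\delta(\lambda\bar e+\bar z)$. Free of torsal rulings (skew) means $\delta(u)\ne0$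 for all $u\in I$. In terms of these invariants: $\Phi$ is a right conoid iff $\kappa=\lambda=0$ on $I$; $\Phi$ lies on a right helicoid iff $\kappa=\lambda=\delta'=0$ on $I$. An Edlinger surface is a ruled surface whose osculating quadrics (limits, along each ruling, of the quadric through three neighbouring rulings) are rotational hyperboloids; equivalently $\delta'=0$ and $1+\kappa\lambda=0$ on $I$. Its osculating hyperboloids are congruent to each other iff in addition $\kappa'=0$ on $I$. Relative normalization. Put $u^1=u$, $u^2=v$. Let $\bar\xi=(\bar x_u\times\bar x_v)/|\bar x_u\times\bar x_v|$ be the Euclidean unit normal, $h_{ij}=\langle\bar\xi,\partial^2\bar x/\partial u^i\partial u^j\rangle$ the second fundamental form with inverse $h^{(ij)}$, and $K$ the Gaussian curvature ($K=-\delta^2/(v^2+\delta^2)^2\neq0$). For $\alpha\in\mathbb{R}$ put $q={}^{(\alpha)}q=|K|^\alpha$ (support function); the relative normalization it determines is ${}^{(\alpha)}\bar y=-h^{(ij)}\frac{\partial q}{\partial u^i}\frac{\partial\bar x}{\partial u^j}+q\,\bar\xi$ (summation over repeated indices). The relative metric is $G_{ij}=q^{-1}h_{ij}$, with inverse $G^{ij}$. The symmetric Darboux tensor is $$A_{jkl}=\frac1q\Big\langle\bar\xi,\frac{\partial^3\bar x}{\partial u^j\partial u^k\partial u^l}\Big\rangle-\frac12\Big(\frac{\partial G_{jk}}{\partial u^l}+\frac{\partial G_{kl}}{\partial u^j}+\frac{\partial G_{lj}}{\partial u^k}\Big).$$ The Tchebychev vector field is ${}^{(\alpha)}\bar T=T^i\,\partial\bar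 x/\partial u^i$ with $T^i=G^{ij}T_j$, $T_i=\frac12A_{ijk}G^{jk}$. Divergence and rotation are taken with respect to the first fundamental form $g_{ij}=\langle\partial_i\bar x,\partial_j\bar x\rangle$. With $w=\sqrt{v^2+\delta^2}=\sqrt{\det(g_{ij})}$: $$\operatorname{div}({}^{(\alpha)}\bar T)=\frac1w\Big(\frac{\partial(wT^1)}{\partial u}+\frac{\partial(wT^2)}{\partial v}\Big),\quad \operatorname{rot}({}^{(\alpha)}\bar T)=\frac1w\Big[\frac{\partial(T^1g_{12}+T^2g_{22})}{\partial u}-\frac{\partial(T^1g_{11}+T^2g_{12})}{\partial v}\Big].$$ *)

(* Defs.v *)
From Stdlib Require Import Reals.
From Coquelicot Require Import Coquelicot.
Open Scope R_scope.

Notation V3 := (R * R * R)%type.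

Definition c1 (p : V3) : R := fst (fst p).
Definition c2 (p : V3) : R := snd (fst p).
Definition c3 (p : V3) : R := snd p.

Definition dot (p q : V3) : R := c1 p * c1 q + c2 p * c2 q + c3 p * c3 q.

Definition cross (p q : V3) : V3 :=
  (c2 p * c3 q - c3 p * c2 q,
   c3 p * c1 q - c1 p * c3 q,
   c1 p * c2 q - c2 p * c1 q).

Definition vnorm (p : V3) : R := sqrt (dot p p).

Definition det3 (p q r : V3) : R := dot p (cross q r).

Definition orthonormal (f1 f2 f3 : V3) : Prop :=
  dot f1 f1 = 1 /\ dot f2 f2 = 1 /\ dot f3 f3 = 1 /\
  dot f1 f2 = 0 /\ dot f1 f3 = 0 /\ dot f2 f3 = 0.

Definition vDerive (f : R -> V3) (t : R) : V3 :=
  (Derive (fun r => c1 (f r)) t,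
   Derive (fun r => c2 (f r)) t,
   Derive (fun r => c3 (f r)) t).

(* Indices of the parameters u^1 = u and u^2 = v. *)
Inductive ix : Set := i1 | i2.

Definition sum_ix (F : ix -> R) : R := F i1 + F i2.

Definition pd (i : ix) (f : R -> R -> R) (u v : R) : R :=
  match i with
  | i1 => Derive (fun t => f t v) u
  | i2 => Derive (fun t => f u t) v
  end.

Definition vpd (i : ix) (f : R -> R -> V3) (u v : R) : V3 :=
  match i with
  | i1 => vDerive (fun t => f t v) u
  | i2 => vDerive (fun t => f u t) v
  end.

Definition det2 (m : ix -> ix -> R) : R := m i1 i1 * m i2 i2 - m i1 i2 * m i2 i1.

Definition inv2 (m : ix -> ix -> R) (i j : ix) : R :=
  match i, j with
  | i1, i1 => m i2 i2 / det2 m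
  | i1, i2 => - m i1 i2 / det2 m
  | i2, i1 => - m i2 i1 / det2 m
  | i2, i2 => m i1 i1 / det2 m
  end.

Definition first_form (x : R -> R -> V3) (u v : R) (i j : ix) : R :=
  dot (vpd i x u v) (vpd j x u v).

Definition unit_normal (x : R -> R -> V3) (u v : R) : V3 :=
  let N := cross (vpd i1 x u v) (vpd i2 x u v) in
  scal (/ vnorm N) N.

Definition second_form (x : R -> R -> V3) (u v : R) (i j : ix) : R :=
  dot (unit_normal x u v) (vpd i (vpd j x) u v).

Definition gauss_curvature (x : R -> R -> V3) (u v : R) : R :=
  det2 (second_form x u v) / det2 (first_form x u v).

(* The relative normalization with support function q. *)
Definition rel_normalization (x : R -> R -> V3) (q : R -> R -> R) (u v : R) : V3 :=
  let c i := sum_ix (fun j => inv2 (second_form x u v) j i * pd j q u v) in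
  plus (scal (- c i1) (vpd i1 x u v))
    (plus (scal (- c i2) (vpd i2 x u v))
       (scal (q u v) (unit_normal x u v))).

Definition K_normalization (x : R -> R -> V3) (alpha : R) : R -> R -> V3 :=
  rel_normalization x (fun u v => Rpower (Rabs (gauss_curvature x u v)) alpha).

(* Left inverse of [rel_normalization x], as the unit normal is orthogonal to
   the tangent plane. *)
Definition support (x y : R -> R -> V3) (u v : R) : R :=
  dot (unit_normal x u v) (y u v).

Definition rel_metric (x y : R -> R -> V3) (i j : ix) (u v : R) : R :=
  / support x y u v * second_form x u v i j.

Definition rel_metric_inv (x y : R -> R -> V3) (i j : ix) (u v : R) : R :=
  inv2 (fun k l => rel_metric x y k l u v) i j.

Definition darboux (x y : R -> R -> V3) (j k l : ix) (u v : R) : R :=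
  / support x y u v * dot (unit_normal x u v) (vpd j (vpd k (vpd l x)) u v)
  - / 2 * (pd l (rel_metric x y j k) u v
           + pd j (rel_metric x y k l) u v
           + pd k (rel_metric x y l j) u v).

Definition tchebychev_cov (x y : R -> R -> V3) (i : ix) (u v : R) : R :=
  / 2 * sum_ix (fun j => sum_ix (fun k =>
          darboux x y i j k u v * rel_metric_inv x y j k u v)).

(* Components T^i of the tangent field T^1 x_u + T^2 x_v. *)
Definition tchebychev (x y : R -> R -> V3) (i : ix) (u v : R) : R :=
  sum_ix (fun j => rel_metric_inv x y i j u v * tchebychev_cov x y j u v).

Definition area_density (x : R -> R -> V3) (u v : R) : R :=
  sqrt (det2 (first_form x u v)).

Definition divergence (x : R -> R -> V3) (T : ix -> R -> R -> R) (u v : R) : R :=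
  / area_density x u v *
  sum_ix (fun i => pd i (fun u' v' => area_density x u' v' * T i u' v') u v).

Definition rotation (x : R -> R -> V3) (T : ix -> R -> R -> R) (u v : R) : R :=
  let low j := fun u' v' => sum_ix (fun i => T i u' v' * first_form x u' v' i j) in
  / area_density x u v * (pd i1 (low i2) u v - pd i2 (low i1) u v).

Definition in_interval (a b : Rbar) (u : R) : Prop := Rbar_lt a u /\ Rbar_lt u b.

Definition C3_on (a b : Rbar) (f : R -> R) : Prop :=
  forall u, in_interval a b u ->
    (forall k, (k <= 3)%nat -> ex_derive_n f k u) /\ continuous (Derive_n f 3) u.

Definition vC3_on (a b : Rbar) (f : R -> V3) : Prop :=
  C3_on a b (fun u => c1 (f u)) /\
  C3_on a b (fun u => c2 (f u)) /\
  C3_on a b (fun u => c3 (f u)).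

Definition ruled (s e : R -> V3) (u v : R) : V3 := plus (s u) (scal v (e u)).

Definition distribution_parameter (s e : R -> V3) (u : R) : R :=
  det3 (vDerive s u) (e u) (vDerive e u).

(* s and e are total functions; only their values on the open interval (a, b)
   matter. *)
Record skew_ruled_surface (a b : Rbar) (s e : R -> V3) : Prop := {
  srs_interval : Rbar_lt a b;
  srs_C3_s : vC3_on a b s;
  srs_C3_e : vC3_on a b e;
  srs_unit : forall u, in_interval a b u -> vnorm (e u) = 1;
  srs_arclength : forall u, in_interval a b u -> vnorm (vDerive e u) = 1;
  srs_striction : forall u, in_interval a b u -> dot (vDerive s u) (vDerive e u) = 0;
  srs_injective : forall u v u' v', in_interval a b u -> in_interval a b u' ->
    ruled s e u v = ruled s e u' v' -> u = u' /\ v = v';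
  srs_immersion : forall u v, in_interval a b u ->
    cross (vpd i1 (ruled s e) u v) (vpd i2 (ruled s e) u v) <> zero;
  srs_skew : forall u, in_interval a b u -> distribution_parameter s e u <> 0
}.

(* All rulings meet one fixed line orthogonally. *)
Definition right_conoid (a b : Rbar) (s e : R -> V3) : Prop :=
  exists o d : V3, dot d d = 1 /\
    forall u, in_interval a b u ->
      dot (e u) d = 0 /\ exists v t, ruled s e u v = plus o (scal t d).

Definition right_helicoid (H : V3 -> Prop) : Prop :=
  exists (o f1 f2 f3 : V3) (h : R), orthonormal f1 f2 f3 /\ h <> 0 /\
    forall p, H p <-> exists r t,
      p = plus o (plus (scal r (plus (scal (cos t) f1) (scal (sin t) f2)))
                       (scal (h * t) f3)).

Definition on_right_helicoid (a b : Rbar) (s e : R -> V3) : Prop :=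
  exists H, right_helicoid H /\ forall u v, in_interval a b u -> H (ruled s e u v).

(* Coefficients of an inhomogeneous quadratic polynomial on R^3: squares, mixed
   products, linear part, constant. *)
Notation quadpoly := (V3 * V3 * V3 * R)%type.

Definition quad_eval (Q : quadpoly) (p : V3) : R :=
  let '(d, m, l, c) := Q in
  let '(x, y, z) := p in
  dot d (x * x, y * y, z * z) + dot m (y * z, z * x, x * y) + dot l p + c.

Definition locus (Q : quadpoly) (p : V3) : Prop := quad_eval Q p = 0.

Definition contains_ruling (s e : R -> V3) (u : R) (Q : quadpoly) : Prop :=
  forall v, locus Q (ruled s e u v).

(* Q is, up to a factor, the limit of the quadric through the rulings u1, u2,
   u3 when these tend to the ruling u. *)
Definition osculating_quadric (a b : Rbar) (s e : R -> V3) (u : R)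
    (Q : quadpoly) : Prop :=
  Q <> zero /\
  forall eps : posreal, exists eta : posreal, forall u1 u2 u3,
    in_interval a b u1 -> in_interval a b u2 -> in_interval a b u3 ->
    u1 <> u2 -> u1 <> u3 -> u2 <> u3 ->
    ball u eta u1 -> ball u eta u2 -> ball u eta u3 ->
    exists Q', Q' <> zero /\ ball Q eps Q' /\
      contains_ruling s e u1 Q' /\ contains_ruling s e u2 Q' /\
      contains_ruling s e u3 Q'.

(* sgn = 1: one sheet; sgn = -1: two sheets. *)
Definition rotational_hyperboloid (H : V3 -> Prop) : Prop :=
  exists (o f1 f2 f3 : V3) (r k sgn : R),
    orthonormal f1 f2 f3 /\ 0 < r /\ 0 < k /\ (sgn = 1 \/ sgn = -1) /\
    forall p, H p <->
      (dot (minus p o) f1 ^ 2 + dot (minus p o) f2 ^ 2) / r ^ 2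
      - dot (minus p o) f3 ^ 2 / k ^ 2 = sgn.

Definition congruent (A B : V3 -> Prop) : Prop :=
  exists o f1 f2 f3 : V3, orthonormal f1 f2 f3 /\
    forall p, A p <->
      B (plus o (plus (scal (c1 p) f1) (plus (scal (c2 p) f2) (scal (c3 p) f3)))).

Definition edlinger (a b : Rbar) (s e : R -> V3) : Prop :=
  forall u, in_interval a b u -> exists Q,
    osculating_quadric a b s e u Q /\ rotational_hyperboloid (locus Q).

Definition congruent_osculating_quadrics (a b : Rbar) (s e : R -> V3) : Prop :=
  forall u u' Q Q', in_interval a b u -> in_interval a b u' ->
    osculating_quadric a b s e u Q -> osculating_quadric a b s e u' Q' ->
    congruent (locus Q) (locus Q').

(* Main.v *)
Require Import Defs.
From Stdlib Require Import Reals.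
From Coquelicot Require Import Coquelicot.
From Stdlib Require Import Lra Psatz.
(* The coordinate projections [c1], [c2], [c3] take precedence over the coercion
   [c1] of the real analysis library. *)
Import Defs.
Open Scope R_scope.

(** The proof computes the Tchebychev field in terms of the invariants kappa,
    delta and lambda, and translates each geometric hypothesis into equations
    between these invariants.

    In the frame e, n = e', z = e x n one has x_u = delta lambda e + v n + delta z
    and x_v = e, so that the normal is (delta n - v z) / w with
    w^2 = v^2 + delta^2. Since h_22 = 0 and
    h_12 = delta / w, the inverse relative metric has G^11 = 0; therefore the
    component A_111, the only one with third derivatives of s, drops out of
    the Tchebychev covector, which turns out to be (alpha - 1/4) grad ln |K|.
    This gives [tchebychev_u] and [tchebychev_v], with
    h_11 w = delta^2 (lambda - kappa) - v delta' - v^2 kappa. From there,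
    divergence and rotation are short computations: for a right conoid
    (kappa = lambda = 0) and alpha = 0 the two terms of the divergence cancel;
    if moreover delta' = 0, then T^2 = 0 and w T^1 does not depend on u; if
    1 + kappa lambda = 0 and kappa, delta are constant, then the covariant
    component of T along x_u is 0 and the one along x_v does not depend on u.

    A right conoid has kappa = lambda = 0 because the direction of its axis is
    +-z ([right_conoid_invariants]). On a right helicoid, a line that is not
    horizontal passes through every point of the axis, in particular through
    the given origin on it; by injectivity no ruling is of this kind, so the
    rulings are the horizontal generators, the surface is a right conoid, and
    delta^2 is the square of the pitch ([on_right_helicoid_invariants]).

    For an Edlinger surface, quadrics through three neighbouring rulings satisfy,
    by Rolle's theorem, the conditions of contact of order 0, 1 and 2 with the
    surface at points nearby. These conditions are linear in the quadric and
    continuous in the point, so that the osculating quadric satisfies them along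
    its ruling ([osculating_contact]), which determines its equation
    ([osculating_form]). A polynomial that vanishes on a rotational hyperboloid
    with semi-axes r, k has a quadratic part with eigenvalues in the ratio
    1 : 1 : - r^2 / k^2 ([hyperboloid_polar]). Comparing the two yields
    delta' = 0, 1 + kappa lambda = 0 and kappa^2 = k^2 / r^2
    ([osculating_hyperboloid_invariants]). Congruence preserves k / r, so
    kappa^2 is constant, and kappa' = 0 since kappa has no zero. *)

(** * Vector algebra *)

Lemma V3_ext (p q : V3) : c1 p = c1 q -> c2 p = c2 q -> c3 p = c3 q -> p = q.
Proof.
  destruct p as [[p1 p2] p3], q as [[q1 q2] q3]; unfold c1, c2, c3; simpl.
  congruence.
Qed.

Lemma c1_plus (p q : V3) : c1 (plus p q) = c1 p + c1 q.
Proof. reflexivity. Qed.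
Lemma c2_plus (p q : V3) : c2 (plus p q) = c2 p + c2 q.
Proof. reflexivity. Qed.
Lemma c3_plus (p q : V3) : c3 (plus p q) = c3 p + c3 q.
Proof. reflexivity. Qed.
Lemma c1_scal k (p : V3) : c1 (scal k p) = k * c1 p.
Proof. reflexivity. Qed.
Lemma c2_scal k (p : V3) : c2 (scal k p) = k * c2 p.
Proof. reflexivity. Qed.
Lemma c3_scal k (p : V3) : c3 (scal k p) = k * c3 p.
Proof. reflexivity. Qed.
Lemma c1_cross p q : c1 (cross p q) = c2 p * c3 q - c3 p * c2 q.
Proof. reflexivity. Qed.
Lemma c2_cross p q : c2 (cross p q) = c3 p * c1 q - c1 p * c3 q.
Proof. reflexivity. Qed.
Lemma c3_cross p q : c3 (cross p q) = c1 p * c2 q - c2 p * c1 q.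
Proof. reflexivity. Qed.
Lemma c1_mk a b c : c1 (a, b, c) = a.
Proof. reflexivity. Qed.
Lemma c2_mk a b c : c2 (a, b, c) = b.
Proof. reflexivity. Qed.
Lemma c3_mk a b c : c3 (a, b, c) = c.
Proof. reflexivity. Qed.
Lemma c1_minus (p q : V3) : c1 (minus p q) = c1 p - c1 q.
Proof. reflexivity. Qed.
Lemma c2_minus (p q : V3) : c2 (minus p q) = c2 p - c2 q.
Proof. reflexivity. Qed.
Lemma c3_minus (p q : V3) : c3 (minus p q) = c3 p - c3 q.
Proof. reflexivity. Qed.

Ltac to_coords :=
  unfold det3, dot in *;
  repeat first
    [ rewrite c1_plus | rewrite c2_plus | rewrite c3_plus
    | rewrite c1_scal | rewrite c2_scal | rewrite c3_scal
    | rewrite c1_cross | rewrite c2_cross | rewrite c3_cross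
    | rewrite c1_minus | rewrite c2_minus | rewrite c3_minus
    | rewrite c1_mk | rewrite c2_mk | rewrite c3_mk ].

Ltac vring := first [apply V3_ext; to_coords; ring | to_coords; ring].

Lemma dot_comm p q : dot p q = dot q p.
Proof. vring. Qed.
Lemma dot_plus_l p q r : dot (plus p q) r = dot p r + dot q r.
Proof. vring. Qed.
Lemma dot_plus_r p q r : dot r (plus p q) = dot r p + dot r q.
Proof. vring. Qed.
Lemma dot_scal_l k p r : dot (scal k p) r = k * dot p r.
Proof. vring. Qed.
Lemma dot_scal_r k p r : dot r (scal k p) = k * dot r p.
Proof. vring. Qed.
Lemma dot_zero_r p : dot p (0, 0, 0) = 0.
Proof. vring. Qed.

Ltac dot_expand :=
  repeat first [ rewrite dot_plus_l | rewrite dot_plus_r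
               | rewrite dot_scal_l | rewrite dot_scal_r ].

Ltac dot_expand_in H :=
  repeat first [ rewrite dot_plus_l in H | rewrite dot_plus_r in H
               | rewrite dot_scal_l in H | rewrite dot_scal_r in H ].

Lemma vnorm_eq_1 p : vnorm p = 1 -> dot p p = 1.
Proof.
  unfold vnorm; intros H.
  rewrite <- (sqrt_sqrt (dot p p)), H; [ring|].
  unfold dot; nra.
Qed.

(** Both sides become equal after multiplication by the determinant of the
    basis, whose square is the Gram determinant, that is 1. *)
Lemma orthonormal_expand f1 f2 f3 p : orthonormal f1 f2 f3 ->
  p = plus (scal (dot p f1) f1) (plus (scal (dot p f2) f2) (scal (dot p f3) f3)).
Proof.
  intros (h11 & h22 & h33 & h12 & h13 & h23).
  set (D := det3 f1 f2 f3).
  (* Cramer's rule, which for p = f1, f2, f3 identifies the cross products. *)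
  assert (cramer : forall q, scal D q =
    plus (scal (dot q f1) (cross f2 f3))
      (plus (scal (dot q f2) (cross f3 f1)) (scal (dot q f3) (cross f1 f2)))).
  { intros q; unfold D; vring. }
  assert (D2 : D * D = 1).
  { transitivity (dot f1 f1 * (dot f2 f2 * dot f3 f3 - dot f2 f3 * dot f2 f3)
      - dot f1 f2 * (dot f1 f2 * dot f3 f3 - dot f2 f3 * dot f1 f3)
      + dot f1 f3 * (dot f1 f2 * dot f2 f3 - dot f2 f2 * dot f1 f3)).
    - unfold D; vring.
    - rewrite h11, h22, h33, h12, h13, h23; ring. }
  assert (k1 : scal D f1 = cross f2 f3).
  { rewrite cramer, h11, h12, h13; vring. }
  assert (k2 : scal D f2 = cross f3 f1).
  { rewrite cramer, (dot_comm f2 f1), h22, h12, h23; vring. }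
  assert (k3 : scal D f3 = cross f1 f2).
  { rewrite cramer, (dot_comm f3 f1), (dot_comm f3 f2), h33, h13, h23; vring. }
  specialize (cramer p); rewrite <- k1, <- k2, <- k3 in cramer.
  assert (forall q r : V3, scal D q = scal D r -> q = r) as cancel.
  { intros q r H.
    replace q with (scal D (scal D q)); [replace r with (scal D (scal D r))|].
    - now rewrite H.
    - apply V3_ext; to_coords; rewrite <- Rmult_assoc, D2; ring.
    - apply V3_ext; to_coords; rewrite <- Rmult_assoc, D2; ring. }
  apply cancel; rewrite cramer; vring.
Qed.

Lemma orthonormal_dot f1 f2 f3 p q : orthonormal f1 f2 f3 ->
  dot p q = dot p f1 * dot q f1 + dot p f2 * dot q f2 + dot p f3 * dot q f3.
Proof.
  intros H; rewrite (orthonormal_expand f1 f2 f3 p H) at 1.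
  dot_expand; rewrite !(dot_comm _ q); ring.
Qed.

Lemma orthonormal_cross p q : dot p p = 1 -> dot q q = 1 -> dot p q = 0 ->
  orthonormal p q (cross p q).
Proof.
  intros hp hq hpq; repeat split; try assumption.
  - transitivity (dot p p * dot q q - dot p q * dot p q); [vring|].
    rewrite hp, hq, hpq; ring.
  - vring.
  - vring.
Qed.

(** * Differentiation of curves *)

Definition v_is_derive (f : R -> V3) (t : R) (l : V3) : Prop :=
  is_derive (fun r => c1 (f r)) t (c1 l) /\
  is_derive (fun r => c2 (f r)) t (c2 l) /\
  is_derive (fun r => c3 (f r)) t (c3 l).

Lemma v_is_derive_unique f t l : v_is_derive f t l -> vDerive f t = l.
Proof.
  intros (h1 & h2 & h3); apply V3_ext; now apply is_derive_unique.
Qed.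

Lemma v_is_derive_const (p : V3) t : v_is_derive (fun _ => p) t (0, 0, 0).
Proof. split; [|split]; apply (@is_derive_const R_AbsRing R_NormedModule). Qed.

Lemma is_derive_Rplus f g t a b : is_derive f t a -> is_derive g t b ->
  is_derive (fun r => f r + g r) t (a + b).
Proof. exact (@is_derive_plus R_AbsRing R_NormedModule f g t a b). Qed.

Lemma is_derive_Rmult f g t a b : is_derive f t a -> is_derive g t b ->
  is_derive (fun r => f r * g r) t (a * g t + f t * b).
Proof.
  intros hf hg; apply (@is_derive_mult R_AbsRing f g t a b hf hg).
  exact Rmult_comm.
Qed.

Lemma v_is_derive_plus f g t a b : v_is_derive f t a -> v_is_derive g t b ->
  v_is_derive (fun r => plus (f r) (g r)) t (plus a b).
Proof.
  intros (f1 & f2 & f3) (g1 & g2 & g3); split; [|split]; now apply is_derive_Rplus.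
Qed.

Lemma v_is_derive_scal f t a k : v_is_derive f t a ->
  v_is_derive (fun r => scal k (f r)) t (scal k a).
Proof.
  intros (f1 & f2 & f3); split; [|split]; now apply is_derive_scal.
Qed.

Lemma is_derive_dot f g t a b : v_is_derive f t a -> v_is_derive g t b ->
  is_derive (fun r => dot (f r) (g r)) t (dot a (g t) + dot (f t) b).
Proof.
  intros (f1 & f2 & f3) (g1 & g2 & g3).
  evar (l : R); replace (dot a (g t) + dot (f t) b) with l; subst l.
  - apply is_derive_Rplus; [apply is_derive_Rplus|]; apply is_derive_Rmult;
      eassumption.
  - simpl; unfold dot; ring.
Qed.

Lemma v_is_derive_cross f g t a b : v_is_derive f t a -> v_is_derive g t b ->
  v_is_derive (fun r => cross (f r) (g r)) t (plus (cross a (g t)) (cross (f t) b)).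
Proof.
  intros (f1 & f2 & f3) (g1 & g2 & g3).
  assert (D : forall p q p' q' : R -> R, forall dp dq dp' dq',
    is_derive p t dp -> is_derive q t dq -> is_derive p' t dp' -> is_derive q' t dq' ->
    is_derive (fun r => p r * q r - p' r * q' r) t
      ((dp * q t - dp' * q' t) + (p t * dq - p' t * dq'))).
  { intros.
    replace ((dp * q t - dp' * q' t) + (p t * dq - p' t * dq'))
      with ((dp * q t + p t * dq) - (dp' * q' t + p' t * dq')) by ring.
    apply (@is_derive_minus R_AbsRing R_NormedModule); now apply is_derive_Rmult. }
  split; [|split]; apply D; assumption.
Qed.

Lemma in_interval_locally a b u : in_interval a b u ->
  locally u (fun t => in_interval a b t).
Proof.
  intros [h1 h2]; apply filter_and.
  - destruct a as [a| |]; simpl in *; try easy.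
    + now apply (open_gt a).
    + now apply filter_forall.
  - destruct b as [b| |]; simpl in *; try easy.
    + now apply (open_lt b).
    + now apply filter_forall.
Qed.

Lemma in_interval_between a b u u' t : in_interval a b u -> in_interval a b u' ->
  Rmin u u' <= t <= Rmax u u' -> in_interval a b t.
Proof.
  intros [h1 h2] [h3 h4] [h5 h6]; unfold Rmin, Rmax in *.
  split.
  - destruct a as [a| |]; simpl in *; try easy; destruct (Rle_dec u u'); lra.
  - destruct b as [b| |]; simpl in *; try easy; destruct (Rle_dec u u'); lra.
Qed.

Lemma derive_zero_constant a b (f : R -> R) :
  (forall u, in_interval a b u -> is_derive f u 0) ->
  forall u u', in_interval a b u -> in_interval a b u' -> f u = f u'.
Proof.
  intros hf u u' hu hu'.
  assert (hb : forall t, Rmin u u' <= t <= Rmax u u' -> is_derive f t 0).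
  { intros t ht; apply hf; now apply (in_interval_between a b u u'). }
  destruct (MVT_gen f u u' (fun _ => 0)) as (c & _ & hc).
  - intros t ht; apply hb; lra.
  - intros t ht; apply continuity_pt_filterlim.
    apply (ex_derive_continuous f); exists 0; now apply hb.
  - lra.
Qed.

(** Two expressions for the derivative at one point agree as soon as the
    functions agree on the whole interval, which is a neighbourhood. *)
Lemma is_derive_interval_unique a b (f g : R -> R) u l l' : in_interval a b u ->
  (forall t, in_interval a b t -> f t = g t) ->
  is_derive f u l -> is_derive g u l' -> l = l'.
Proof.
  intros hu heq hf hg.
  rewrite <- (is_derive_unique _ _ _ hf), <- (is_derive_unique _ _ _ hg).
  apply Derive_ext_loc.
  apply filter_imp with (2 := in_interval_locally a b u hu); exact heq.
Qed.

Lemma C3_is_derive a b (f : R -> R) u k : C3_on a b f -> in_interval a b u ->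
  (k < 3)%nat -> is_derive (Derive_n f k) u (Derive_n f (S k) u).
Proof.
  intros hf hu hk; destruct (hf u hu) as [hd _].
  apply Derive_correct; exact (hd (S k) hk).
Qed.

Lemma vC3_v_is_derive a b (f : R -> V3) u : vC3_on a b f -> in_interval a b u ->
  v_is_derive f u (vDerive f u) /\
  v_is_derive (vDerive f) u (vDerive (vDerive f) u) /\
  v_is_derive (vDerive (vDerive f)) u (vDerive (vDerive (vDerive f)) u).
Proof.
  intros (h1 & h2 & h3) hu.
  assert (D : forall g k, C3_on a b g -> (k < 3)%nat ->
    is_derive (Derive_n g k) u (Derive_n g (S k) u)).
  { intros g k hg hk; exact (C3_is_derive a b g u k hg hu hk). }
  split; [|split]; (split; [|split]).
  - now apply (D _ 0%nat h1); repeat constructor.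
  - now apply (D _ 0%nat h2); repeat constructor.
  - now apply (D _ 0%nat h3); repeat constructor.
  - now apply (D _ 1%nat h1); repeat constructor.
  - now apply (D _ 1%nat h2); repeat constructor.
  - now apply (D _ 1%nat h3); repeat constructor.
  - now apply (D _ 2%nat h1); repeat constructor.
  - now apply (D _ 2%nat h2); repeat constructor.
  - now apply (D _ 2%nat h3); repeat constructor.
Qed.

(** * The moving frame of a skew ruled surface *)

Definition conical_curvature (e : R -> V3) (u : R) : R :=
  det3 (e u) (vDerive e u) (vDerive (vDerive e) u).

(** The product delta * lambda of the fundamental invariants, which serves
    instead of lambda because it needs no division by delta. *)
Definition striction_component (s e : R -> V3) (u : R) : R :=
  dot (vDerive s u) (e u).

Definition frame_z (e : R -> V3) (u : R) : V3 := cross (e u) (vDerive e u).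

Section Frame.
Context (a b : Rbar) (s e : R -> V3) (hPhi : skew_ruled_surface a b s e).

Local Notation I := (in_interval a b).
Local Notation n := (vDerive e).
Local Notation z := (frame_z e).
Local Notation de := (distribution_parameter s e).
Local Notation ka := (conical_curvature e).
Local Notation m := (striction_component s e).

Lemma ruling_unit u : I u -> dot (e u) (e u) = 1.
Proof. intros hu; apply vnorm_eq_1, (srs_unit _ _ _ _ hPhi u hu). Qed.

Lemma ruling_derive_unit u : I u -> dot (n u) (n u) = 1.
Proof. intros hu; apply vnorm_eq_1, (srs_arclength _ _ _ _ hPhi u hu). Qed.

Lemma derive_s u : I u -> v_is_derive s u (vDerive s u) /\
  v_is_derive (vDerive s) u (vDerive (vDerive s) u) /\
  v_is_derive (vDerive (vDerive s)) u (vDerive (vDerive (vDerive s)) u).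
Proof. exact (vC3_v_is_derive a b s u (srs_C3_s _ _ _ _ hPhi)). Qed.

Lemma derive_e u : I u -> v_is_derive e u (n u) /\
  v_is_derive n u (vDerive n u) /\
  v_is_derive (vDerive n) u (vDerive (vDerive n) u).
Proof. exact (vC3_v_is_derive a b e u (srs_C3_e _ _ _ _ hPhi)). Qed.

Lemma dot_constant_derive (f g : R -> V3) u f' g' k : I u ->
  (forall t, I t -> dot (f t) (g t) = k) ->
  v_is_derive f u f' -> v_is_derive g u g' ->
  dot f' (g u) + dot (f u) g' = 0.
Proof.
  intros hu heq hf hg.
  apply (is_derive_interval_unique a b (fun t => dot (f t) (g t)) (fun _ => k) u).
  - exact hu.
  - exact heq.
  - now apply is_derive_dot.
  - apply (@is_derive_const R_AbsRing R_NormedModule).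
Qed.

Lemma ruling_orth_derive u : I u -> dot (e u) (n u) = 0.
Proof.
  intros hu; destruct (derive_e u hu) as (d1 & _ & _).
  pose proof (dot_constant_derive e e u _ _ 1 hu ruling_unit d1 d1) as H.
  rewrite (dot_comm (n u)) in H; lra.
Qed.

Lemma frame_orthonormal u : I u -> orthonormal (e u) (n u) (z u).
Proof.
  intros hu; apply orthonormal_cross;
    auto using ruling_unit, ruling_derive_unit, ruling_orth_derive.
Qed.

Lemma z_dot_e u : dot (z u) (e u) = 0.
Proof. unfold frame_z; vring. Qed.

Lemma z_dot_n u : dot (z u) (n u) = 0.
Proof. unfold frame_z; vring. Qed.

Lemma z_dot_z u : I u -> dot (z u) (z u) = 1.
Proof. intros hu; apply (frame_orthonormal u hu). Qed.

Lemma s1_dot_z u : dot (vDerive s u) (z u) = de u.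
Proof. reflexivity. Qed.

Lemma s1_dot_n u : I u -> dot (vDerive s u) (n u) = 0.
Proof. apply (srs_striction _ _ _ _ hPhi). Qed.

Lemma s1_expand u : I u ->
  vDerive s u = plus (scal (m u) (e u)) (scal (de u) (z u)).
Proof.
  intros hu.
  rewrite (orthonormal_expand _ _ _ (vDerive s u) (frame_orthonormal u hu)).
  rewrite s1_dot_n, s1_dot_z by exact hu; fold (m u); vring.
Qed.

Lemma e2_dot_e u : I u -> dot (vDerive n u) (e u) = - 1.
Proof.
  intros hu; destruct (derive_e u hu) as (d1 & d2 & _).
  pose proof (dot_constant_derive e n u _ _ 0 hu ruling_orth_derive d1 d2) as H.
  rewrite ruling_derive_unit, (dot_comm (e u)) in H by exact hu; lra.
Qed.

Lemma e2_dot_n u : I u -> dot (vDerive n u) (n u) = 0.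
Proof.
  intros hu; destruct (derive_e u hu) as (d1 & d2 & _).
  pose proof (dot_constant_derive n n u _ _ 1 hu ruling_derive_unit d2 d2) as H.
  rewrite (dot_comm (n u)) in H; lra.
Qed.

Lemma e2_dot_z u : dot (vDerive n u) (z u) = ka u.
Proof. unfold frame_z, conical_curvature; vring. Qed.

Lemma s2_dot_n u : I u ->
  dot (vDerive (vDerive s) u) (n u) = m u - ka u * de u.
Proof.
  intros hu; destruct (derive_e u hu) as (_ & d2 & _).
  destruct (derive_s u hu) as (_ & d2s & _).
  pose proof (dot_constant_derive _ n u _ _ 0 hu s1_dot_n d2s d2) as H.
  rewrite (s1_expand u hu) in H; dot_expand_in H.
  rewrite !(dot_comm _ (vDerive n u)), e2_dot_e, e2_dot_z in H by exact hu; lra.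
Qed.

(** The derivative of z contributes nothing, being a multiple of n, which is
    orthogonal to s'. *)
Lemma de_is_derive u : I u -> is_derive de u (dot (vDerive (vDerive s) u) (z u)).
Proof.
  intros hu; destruct (derive_e u hu) as (d1 & d2 & _).
  destruct (derive_s u hu) as (_ & d2s & _).
  pose proof (is_derive_dot _ _ _ _ _ d2s (v_is_derive_cross _ _ _ _ _ d1 d2)) as H.
  replace (dot (vDerive (vDerive s) u) (z u)) with
    (dot (vDerive (vDerive s) u) (cross (e u) (n u)) +
     dot (vDerive s u) (plus (cross (n u) (n u)) (cross (e u) (vDerive n u)))).
  { exact H. }
  fold (z u).
  assert (E : dot (vDerive s u) (plus (cross (n u) (n u)) (cross (e u) (vDerive n u))) = 0).
  { rewrite (orthonormal_expand _ _ _ (vDerive n u) (frame_orthonormal u hu)).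
    rewrite e2_dot_e, e2_dot_n, e2_dot_z by exact hu.
    transitivity (ka u * (dot (e u) (n u) * dot (vDerive s u) (e u)
      - dot (e u) (e u) * dot (vDerive s u) (n u))).
    - unfold frame_z; vring.
    - rewrite s1_dot_n, ruling_orth_derive by exact hu; ring. }
  rewrite E; ring.
Qed.

Lemma s2_dot_z u : I u -> dot (vDerive (vDerive s) u) (z u) = Derive de u.
Proof. intros hu; symmetry; now apply is_derive_unique, de_is_derive. Qed.

Lemma de_derive u : I u -> is_derive de u (Derive de u).
Proof. intros hu; rewrite <- s2_dot_z by exact hu; now apply de_is_derive. Qed.

Lemma ka_derive u : I u -> is_derive ka u (Derive ka u).
Proof.
  intros hu; destruct (derive_e u hu) as (d1 & d2 & d3).
  apply Derive_correct; eexists; unfold conical_curvature, det3.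
  apply is_derive_dot; [exact d1|]; apply v_is_derive_cross; eassumption.
Qed.

Lemma de_neq_0 u : I u -> de u <> 0.
Proof. apply (srs_skew _ _ _ _ hPhi). Qed.

End Frame.

(** * The Tchebychev vector field in terms of the invariants *)

(** The value |K|^alpha of the support function where delta = d. *)
Definition support_value (alpha d v : R) : R :=
  Rpower (d ^ 2 / (v ^ 2 + d ^ 2) ^ 2) alpha.

(** The common factor of the relative metric: G_12 = delta * metric_factor,
    while G_11 is metric_factor times a quadratic polynomial in v. *)
Definition metric_factor (alpha d v : R) : R :=
  / support_value alpha d v * / sqrt (v ^ 2 + d ^ 2).

Lemma radicand_pos d v : d <> 0 -> 0 < v ^ 2 + d ^ 2.
Proof. intros hd; assert (0 < d ^ 2) by (apply pow2_gt_0; exact hd); nra. Qed.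

Lemma sqrt_radicand_pos d v : d <> 0 -> 0 < sqrt (v ^ 2 + d ^ 2).
Proof. intros hd; now apply sqrt_lt_R0, radicand_pos. Qed.

Lemma support_value_pos alpha d v : 0 < support_value alpha d v.
Proof. apply exp_pos. Qed.

Lemma metric_factor_neq_0 alpha d v : d <> 0 -> metric_factor alpha d v <> 0.
Proof.
  intros hd; unfold metric_factor.
  pose proof (support_value_pos alpha d v); pose proof (sqrt_radicand_pos d v hd).
  apply Rmult_integral_contrapositive_currified; apply Rinv_neq_0_compat; lra.
Qed.

Lemma metric_factor_derive_v alpha d v : d <> 0 ->
  is_derive (fun t => metric_factor alpha d t) v
    ((4 * alpha - 1) * v / (v ^ 2 + d ^ 2) * metric_factor alpha d v).
Proof.
  intros hd; pose proof (radicand_pos d v hd) as hW.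
  assert (hd2 : 0 < d ^ 2) by (apply pow2_gt_0; exact hd).
  assert (hq : 0 < d ^ 2 / (v ^ 2 + d ^ 2) ^ 2).
  { apply Rdiv_lt_0_compat; [exact hd2|]; now apply pow_lt. }
  pose proof (sqrt_radicand_pos d v hd) as hw.
  unfold metric_factor, support_value, Rpower.
  auto_derive.
  - repeat split; try (simpl in *; lra); try exact hq.
    all: try (apply Rgt_not_eq, exp_pos).
    all: try (apply Rmult_integral_contrapositive_currified; simpl in *; lra).
  - set (E := exp _); assert (hE : 0 < E) by apply exp_pos.
    pose proof (sqrt_sqrt (v ^ 2 + d ^ 2) (Rlt_le _ _ hW)) as hs.
    set (r := sqrt (v ^ 2 + d ^ 2)) in *.
    change (v * (v * 1) + d * (d * 1)) with (v ^ 2 + d ^ 2) in *.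
    fold r.
    rewrite <- hs in *; field; lra.
Qed.

Lemma metric_factor_derive_d alpha d v : d <> 0 ->
  is_derive (fun t => metric_factor alpha t v) d
    ((- alpha * (2 / d - 4 * d / (v ^ 2 + d ^ 2)) - d / (v ^ 2 + d ^ 2))
       * metric_factor alpha d v).
Proof.
  intros hd; pose proof (radicand_pos d v hd) as hW.
  assert (hd2 : 0 < d ^ 2) by (apply pow2_gt_0; exact hd).
  assert (hq : 0 < d ^ 2 / (v ^ 2 + d ^ 2) ^ 2).
  { apply Rdiv_lt_0_compat; [exact hd2|]; now apply pow_lt. }
  pose proof (sqrt_radicand_pos d v hd) as hw.
  unfold metric_factor, support_value, Rpower.
  auto_derive.
  - repeat split; try (simpl in *; lra); try exact hq.
    all: try (apply Rgt_not_eq, exp_pos).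
    all: try (apply Rmult_integral_contrapositive_currified; simpl in *; lra).
  - set (E := exp _); assert (hE : 0 < E) by apply exp_pos.
    pose proof (sqrt_sqrt (v ^ 2 + d ^ 2) (Rlt_le _ _ hW)) as hs.
    set (r := sqrt (v ^ 2 + d ^ 2)) in *.
    change (v * (v * 1) + d * (d * 1)) with (v ^ 2 + d ^ 2) in *.
    fold r.
    rewrite <- hs in *; field; lra.
Qed.

Lemma pd_congr a b i (F G : R -> R -> R) u v : in_interval a b u ->
  (forall t r, in_interval a b t -> F t r = G t r) -> pd i F u v = pd i G u v.
Proof.
  intros hu heq; destruct i; simpl.
  - apply Derive_ext_loc.
    apply filter_imp with (2 := in_interval_locally a b u hu).
    intros t ht; now apply heq.
  - apply Derive_ext; intros t; now apply heq.
Qed.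

Lemma pd_const i (k u v : R) : pd i (fun _ _ => k) u v = 0.
Proof. destruct i; [exact (Derive_const k u) | exact (Derive_const k v)]. Qed.

Lemma vpd_congr a b i (F G : R -> R -> V3) u v : in_interval a b u ->
  (forall t r, in_interval a b t -> F t r = G t r) -> vpd i F u v = vpd i G u v.
Proof.
  intros hu heq.
  assert (hc : forall c : V3 -> R,
    pd i (fun t r => c (F t r)) u v = pd i (fun t r => c (G t r)) u v).
  { intros c; apply (pd_congr a b); [exact hu|].
    intros t r ht; now rewrite heq. }
  destruct i; apply V3_ext; [apply (hc c1) | apply (hc c2) | apply (hc c3)
    | apply (hc c1) | apply (hc c2) | apply (hc c3)].
Qed.

Section Tchebychev.
Context (a b : Rbar) (s e : R -> V3) (hPhi : skew_ruled_surface a b s e).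
Context (alpha : R).

Local Notation I := (in_interval a b).
Local Notation x := (ruled s e).
Local Notation n := (vDerive e).
Local Notation z := (frame_z e).
Local Notation de := (distribution_parameter s e).
Local Notation ka := (conical_curvature e).
Local Notation m := (striction_component s e).
Local Notation y := (K_normalization x alpha).
Local Notation w u v := (sqrt (v ^ 2 + de u ^ 2)).
Local Notation phi u v := (metric_factor alpha (de u) v).

Lemma ruled_u u v : I u -> vpd i1 x u v = plus (vDerive s u) (scal v (n u)).
Proof.
  intros hu; apply v_is_derive_unique, v_is_derive_plus.
  - apply (derive_s a b s e hPhi u hu).
  - apply v_is_derive_scal, (derive_e a b s e hPhi u hu).
Qed.

Lemma v_is_derive_line (p q : V3) t : v_is_derive (fun r => plus p (scal r q)) t q.
Proof.
  assert (D : forall k l : R, is_derive (fun r => k + r * l) t l).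
  { intros k l; auto_derive; [exact Logic.I | ring]. }
  split; [|split]; apply D.
Qed.

Lemma ruled_v u v : vpd i2 x u v = e u.
Proof. apply v_is_derive_unique, v_is_derive_line. Qed.

Lemma ruled_uu u v : I u -> vpd i1 (vpd i1 x) u v =
  plus (vDerive (vDerive s) u) (scal v (vDerive n u)).
Proof.
  intros hu; rewrite (vpd_congr a b i1 _ _ u v hu ruled_u).
  apply v_is_derive_unique, v_is_derive_plus.
  - apply (derive_s a b s e hPhi u hu).
  - apply v_is_derive_scal, (derive_e a b s e hPhi u hu).
Qed.

Lemma ruled_uv u v : I u -> vpd i1 (vpd i2 x) u v = n u.
Proof.
  intros hu; rewrite (vpd_congr a b i1 _ (fun t _ => e t) u v hu).
  - reflexivity.
  - intros; apply ruled_v.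
Qed.

Lemma ruled_vu u v : I u -> vpd i2 (vpd i1 x) u v = n u.
Proof.
  intros hu; rewrite (vpd_congr a b i2 _ _ u v hu ruled_u).
  apply v_is_derive_unique, v_is_derive_line.
Qed.

Lemma vpd_v_const (f : R -> V3) u v : vpd i2 (fun t _ => f t) u v = (0, 0, 0).
Proof. apply v_is_derive_unique, v_is_derive_const. Qed.

Lemma ruled_vv u v : I u -> vpd i2 (vpd i2 x) u v = (0, 0, 0).
Proof.
  intros hu; rewrite (vpd_congr a b i2 _ (fun t _ => e t) u v hu).
  - apply vpd_v_const.
  - intros; apply ruled_v.
Qed.

Lemma ruled_uuv u v : I u -> vpd i1 (vpd i1 (vpd i2 x)) u v = vDerive n u.
Proof.
  intros hu; rewrite (vpd_congr a b i1 _ (fun t _ => n t) u v hu).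
  - reflexivity.
  - intros; now apply ruled_uv.
Qed.

Lemma ruled_uvu u v : I u -> vpd i1 (vpd i2 (vpd i1 x)) u v = vDerive n u.
Proof.
  intros hu; rewrite (vpd_congr a b i1 _ (fun t _ => n t) u v hu).
  - reflexivity.
  - intros; now apply ruled_vu.
Qed.

Lemma ruled_uvv u v : I u -> vpd i1 (vpd i2 (vpd i2 x)) u v = (0, 0, 0).
Proof.
  intros hu; rewrite (vpd_congr a b i1 _ (fun t _ => (0, 0, 0)) u v hu).
  - apply v_is_derive_unique, v_is_derive_const.
  - intros; now apply ruled_vv.
Qed.

Lemma ruled_vuv u v : I u -> vpd i2 (vpd i1 (vpd i2 x)) u v = (0, 0, 0).
Proof.
  intros hu; rewrite (vpd_congr a b i2 _ (fun t _ => n t) u v hu).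
  - apply vpd_v_const.
  - intros; now apply ruled_uv.
Qed.

Lemma ruled_vvu u v : I u -> vpd i2 (vpd i2 (vpd i1 x)) u v = (0, 0, 0).
Proof.
  intros hu; rewrite (vpd_congr a b i2 _ (fun t _ => n t) u v hu).
  - apply vpd_v_const.
  - intros; now apply ruled_vu.
Qed.

Lemma ruled_vvv u v : I u -> vpd i2 (vpd i2 (vpd i2 x)) u v = (0, 0, 0).
Proof.
  intros hu; rewrite (vpd_congr a b i2 _ (fun t _ => (0, 0, 0)) u v hu).
  - apply vpd_v_const.
  - intros; now apply ruled_vv.
Qed.

Lemma first_form_uu u v : I u ->
  first_form x u v i1 i1 = m u ^ 2 + de u ^ 2 + v ^ 2.
Proof.
  intros hu; unfold first_form; rewrite ruled_u, (s1_expand a b s e hPhi) by exact hu.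
  dot_expand.
  rewrite !(dot_comm (n u)), !(dot_comm (e u) (z u)), z_dot_n, z_dot_e,
    (z_dot_z a b s e hPhi), (ruling_unit a b s e hPhi),
    (ruling_orth_derive a b s e hPhi), (ruling_derive_unit a b s e hPhi)
    by exact hu.
  ring.
Qed.

Lemma first_form_uv u v : I u -> first_form x u v i1 i2 = m u.
Proof.
  intros hu; unfold first_form; rewrite ruled_u, ruled_v by exact hu.
  dot_expand.
  rewrite (dot_comm (n u)), (ruling_orth_derive a b s e hPhi) by exact hu.
  unfold striction_component; ring.
Qed.

Lemma first_form_vu u v : I u -> first_form x u v i2 i1 = m u.
Proof.
  intros hu; rewrite <- (first_form_uv u v hu); unfold first_form; apply dot_comm.
Qed.

Lemma first_form_vv u v : I u -> first_form x u v i2 i2 = 1.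
Proof.
  intros hu; unfold first_form; rewrite ruled_v; now apply (ruling_unit a b s e hPhi).
Qed.

Lemma first_form_det u v : I u -> det2 (first_form x u v) = v ^ 2 + de u ^ 2.
Proof.
  intros hu; unfold det2.
  rewrite first_form_uu, first_form_uv, first_form_vu, first_form_vv by exact hu.
  ring.
Qed.

Lemma area_density_eq u v : I u -> area_density x u v = w u v.
Proof. intros hu; unfold area_density; now rewrite first_form_det. Qed.

Lemma normal_eq u v : I u ->
  cross (vpd i1 x u v) (vpd i2 x u v) = plus (scal (de u) (n u)) (scal (- v) (z u)).
Proof.
  intros hu; rewrite ruled_u, ruled_v, (s1_expand a b s e hPhi) by exact hu.
  pose proof (ruling_unit a b s e hPhi u hu) as h1.
  pose proof (ruling_orth_derive a b s e hPhi u hu) as h2.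
  assert (hz : cross (z u) (e u) = n u).
  { transitivity (plus (scal (dot (e u) (e u)) (n u))
                    (scal (- dot (e u) (n u)) (e u))).
    - unfold frame_z; vring.
    - rewrite h1, h2; vring. }
  rewrite <- hz at 2; unfold frame_z; vring.
Qed.

Lemma unit_normal_eq u v : I u -> unit_normal x u v =
  scal (/ w u v) (plus (scal (de u) (n u)) (scal (- v) (z u))).
Proof.
  intros hu; unfold unit_normal; rewrite normal_eq by exact hu.
  do 2 f_equal; unfold vnorm; f_equal; dot_expand.
  rewrite !(dot_comm (n u) (z u)), z_dot_n, (z_dot_z a b s e hPhi),
    (ruling_derive_unit a b s e hPhi) by exact hu.
  ring.
Qed.

(** The numerator, over w, of the coefficient h_11 of the second fundamental
    form. *)
Definition h11_poly (u v : R) : R :=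
  de u * (m u - ka u * de u) - v * Derive de u - v ^ 2 * ka u.

Lemma second_form_uu u v : I u ->
  second_form x u v i1 i1 = / w u v * h11_poly u v.
Proof.
  intros hu; unfold second_form; rewrite unit_normal_eq, ruled_uu by exact hu.
  dot_expand.
  rewrite !(dot_comm (n u) (vDerive _ _)), !(dot_comm (z u)).
  rewrite (s2_dot_n a b s e hPhi), (s2_dot_z a b s e hPhi), (e2_dot_n a b s e hPhi),
    e2_dot_z by exact hu.
  unfold h11_poly; ring.
Qed.

Lemma unit_normal_dot_n u v : I u -> dot (unit_normal x u v) (n u) = / w u v * de u.
Proof.
  intros hu; rewrite unit_normal_eq by exact hu; dot_expand.
  rewrite z_dot_n, (ruling_derive_unit a b s e hPhi) by exact hu; ring.
Qed.

Lemma second_form_uv u v : I u -> second_form x u v i1 i2 = / w u v * de u.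
Proof.
  intros hu; unfold second_form; rewrite ruled_uv by exact hu.
  now apply unit_normal_dot_n.
Qed.

Lemma second_form_vu u v : I u -> second_form x u v i2 i1 = / w u v * de u.
Proof.
  intros hu; unfold second_form; rewrite ruled_vu by exact hu.
  now apply unit_normal_dot_n.
Qed.

Lemma second_form_vv u v : I u -> second_form x u v i2 i2 = 0.
Proof.
  intros hu; unfold second_form; rewrite ruled_vv by exact hu; apply dot_zero_r.
Qed.

Lemma radicand_pos' u v : I u -> 0 < v ^ 2 + de u ^ 2.
Proof. intros hu; apply radicand_pos, (de_neq_0 a b s e hPhi u hu). Qed.

Lemma w_pos u v : I u -> 0 < w u v.
Proof. intros hu; now apply sqrt_lt_R0, radicand_pos'. Qed.

Lemma w_sqr u v : I u -> w u v * w u v = v ^ 2 + de u ^ 2.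
Proof. intros hu; apply sqrt_sqrt, Rlt_le, radicand_pos'; exact hu. Qed.

Lemma gauss_curvature_abs u v : I u ->
  Rabs (gauss_curvature x u v) = de u ^ 2 / (v ^ 2 + de u ^ 2) ^ 2.
Proof.
  intros hu; pose proof (radicand_pos' u v hu) as hW.
  pose proof (w_pos u v hu) as hw; pose proof (w_sqr u v hu) as hww.
  unfold gauss_curvature; rewrite first_form_det by exact hu; unfold det2.
  rewrite second_form_uu, second_form_uv, second_form_vu, second_form_vv by exact hu.
  replace (_ / _) with (- (de u ^ 2 / (v ^ 2 + de u ^ 2) ^ 2)).
  - rewrite Rabs_Ropp; apply Rabs_pos_eq.
    apply Rmult_le_pos; [apply pow2_ge_0|].
    apply Rlt_le, Rinv_0_lt_compat; now apply pow_lt.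
  - set (W := w u v) in *; rewrite <- hww in *; field; lra.
Qed.

Lemma support_eq u v : I u -> support x y u v = support_value alpha (de u) v.
Proof.
  intros hu; pose proof (w_pos u v hu) as hw; pose proof (w_sqr u v hu) as hww.
  unfold support, K_normalization, rel_normalization; dot_expand.
  rewrite gauss_curvature_abs by exact hu; fold (support_value alpha (de u) v).
  assert (ht1 : dot (unit_normal x u v) (vpd i1 x u v) = 0).
  { unfold unit_normal; dot_expand.
    replace (dot (cross _ _) _) with 0 by vring; ring. }
  assert (ht2 : dot (unit_normal x u v) (vpd i2 x u v) = 0).
  { unfold unit_normal; dot_expand.
    replace (dot (cross _ _) _) with 0 by vring; ring. }
  assert (hnn : dot (unit_normal x u v) (unit_normal x u v) = 1).
  { rewrite unit_normal_eq by exact hu; dot_expand.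
    rewrite !(dot_comm (n u) (z u)), z_dot_n, (z_dot_z a b s e hPhi),
      (ruling_derive_unit a b s e hPhi) by exact hu.
    set (W := w u v) in *.
    transitivity (/ (W * W) * (v ^ 2 + de u ^ 2)); [field; lra|].
    rewrite hww; field; pose proof (radicand_pos' u v hu); lra. }
  rewrite ht1, ht2, hnn; ring.
Qed.

Lemma metric_uu u v : I u -> rel_metric x y i1 i1 u v = phi u v * h11_poly u v.
Proof.
  intros hu; unfold rel_metric; rewrite support_eq, second_form_uu by exact hu.
  unfold metric_factor; ring.
Qed.

Lemma metric_uv u v : I u -> rel_metric x y i1 i2 u v = phi u v * de u.
Proof.
  intros hu; unfold rel_metric; rewrite support_eq, second_form_uv by exact hu.
  unfold metric_factor; ring.
Qed.

Lemma metric_vu u v : I u -> rel_metric x y i2 i1 u v = phi u v * de u.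
Proof.
  intros hu; unfold rel_metric; rewrite support_eq, second_form_vu by exact hu.
  unfold metric_factor; ring.
Qed.

Lemma metric_vv u v : I u -> rel_metric x y i2 i2 u v = 0.
Proof.
  intros hu; unfold rel_metric; rewrite second_form_vv by exact hu; ring.
Qed.

Lemma phi_neq_0 u v : I u -> phi u v <> 0.
Proof. intros hu; apply metric_factor_neq_0, (de_neq_0 a b s e hPhi u hu). Qed.

Lemma metric_inv_uu u v : I u -> rel_metric_inv x y i1 i1 u v = 0.
Proof.
  intros hu; unfold rel_metric_inv, inv2; rewrite metric_vv by exact hu.
  unfold Rdiv; ring.
Qed.

Lemma metric_inv_uv u v : I u -> rel_metric_inv x y i1 i2 u v = / (phi u v * de u).
Proof.
  intros hu; unfold rel_metric_inv, inv2, det2.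
  rewrite metric_uu, metric_vv, metric_uv, metric_vu by exact hu.
  field; split; [now apply (de_neq_0 a b s e hPhi) | now apply phi_neq_0].
Qed.

Lemma metric_inv_vu u v : I u -> rel_metric_inv x y i2 i1 u v = / (phi u v * de u).
Proof.
  intros hu; unfold rel_metric_inv, inv2, det2.
  rewrite metric_uu, metric_vv, metric_uv, metric_vu by exact hu.
  field; split; [now apply (de_neq_0 a b s e hPhi) | now apply phi_neq_0].
Qed.

Lemma metric_inv_vv u v : I u ->
  rel_metric_inv x y i2 i2 u v = - h11_poly u v / (phi u v * de u ^ 2).
Proof.
  intros hu; unfold rel_metric_inv, inv2, det2.
  rewrite metric_uu, metric_vv, metric_uv, metric_vu by exact hu.
  field; split; [now apply (de_neq_0 a b s e hPhi) | now apply phi_neq_0].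
Qed.

Lemma pd_v_metric_uu u v : I u -> pd i2 (rel_metric x y i1 i1) u v =
  phi u v * ((4 * alpha - 1) * v / (v ^ 2 + de u ^ 2) * h11_poly u v
             - Derive de u - 2 * v * ka u).
Proof.
  intros hu; rewrite (pd_congr a b i2 _ _ u v hu metric_uu).
  apply is_derive_unique.
  evar (l : R); replace (phi u v * _) with l; subst l.
  - apply is_derive_Rmult.
    + apply metric_factor_derive_v, (de_neq_0 a b s e hPhi u hu).
    + unfold h11_poly; auto_derive; [exact Logic.I | reflexivity].
  - simpl; unfold Rdiv; ring.
Qed.

Lemma pd_v_metric_uv u v : I u -> pd i2 (fun t r => phi t r * de t) u v =
  phi u v * ((4 * alpha - 1) * v / (v ^ 2 + de u ^ 2) * de u).
Proof.
  intros hu; apply is_derive_unique.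
  evar (l : R); replace (phi u v * _) with l; subst l.
  - apply is_derive_Rmult.
    + apply metric_factor_derive_v, (de_neq_0 a b s e hPhi u hu).
    + apply (@is_derive_const R_AbsRing R_NormedModule).
  - unfold zero; simpl; unfold Rdiv; ring.
Qed.

Lemma pd_u_metric_uv u v : I u -> pd i1 (fun t r => phi t r * de t) u v =
  phi u v * Derive de u *
  (1 - 2 * alpha + (4 * alpha - 1) * de u ^ 2 / (v ^ 2 + de u ^ 2)).
Proof.
  intros hu; pose proof (de_neq_0 a b s e hPhi u hu) as hd.
  apply is_derive_unique.
  evar (l : R); replace (phi u v * _ * _) with l; subst l.
  - apply is_derive_Rmult.
    + apply (is_derive_comp (fun d => metric_factor alpha d v) de u).
      * now apply metric_factor_derive_d.
      * now apply (de_derive a b s e hPhi).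
    + now apply (de_derive a b s e hPhi).
  - unfold scal; simpl; unfold mult; simpl; field.
    pose proof (radicand_pos' u v hu); simpl in *; lra.
Qed.

(** The right-hand side is (alpha - 1/4) d(ln |K|)/du, as |K| = (delta / w^2)^2. *)
Lemma tchebychev_cov_u u v : I u -> tchebychev_cov x y i1 u v =
  (4 * alpha - 1) * / 2 * Derive de u * (v ^ 2 - de u ^ 2)
    / (de u * (v ^ 2 + de u ^ 2)).
Proof.
  intros hu; pose proof (de_neq_0 a b s e hPhi u hu) as hd.
  pose proof (w_pos u v hu) as hw; pose proof (w_sqr u v hu) as hww.
  pose proof (radicand_pos' u v hu) as hW.
  pose proof (support_value_pos alpha (de u) v) as hq.
  unfold tchebychev_cov, sum_ix.
  rewrite metric_inv_uu, metric_inv_uv, metric_inv_vu, metric_inv_vv by exact hu.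
  unfold darboux.
  (* A_111 is not expanded: its factor G^11 is 0. *)
  rewrite ruled_uuv, ruled_uvu, ruled_uvv, dot_zero_r by exact hu.
  rewrite support_eq, pd_v_metric_uu by exact hu.
  rewrite !(pd_congr a b _ _ _ u v hu metric_uv),
    !(pd_congr a b _ _ _ u v hu metric_vu),
    !(pd_congr a b _ _ (fun _ _ => 0) u v hu metric_vv).
  rewrite pd_v_metric_uv, pd_u_metric_uv by exact hu.
  rewrite pd_const.
  rewrite unit_normal_eq by exact hu; dot_expand.
  rewrite !(dot_comm (n u) (vDerive _ _)), !(dot_comm (z u)).
  rewrite (e2_dot_n a b s e hPhi), e2_dot_z by exact hu.
  unfold metric_factor, h11_poly in *.
  set (W := w u v) in *; set (q := support_value _ _ _) in *.
  assert (hv : v ^ 2 = W * W - de u ^ 2) by lra.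
  rewrite hv; field; repeat split; nra.
Qed.

(** Likewise (alpha - 1/4) d(ln |K|)/dv. *)
Lemma tchebychev_cov_v u v : I u -> tchebychev_cov x y i2 u v =
  (1 - 4 * alpha) * v / (v ^ 2 + de u ^ 2).
Proof.
  intros hu; pose proof (de_neq_0 a b s e hPhi u hu) as hd.
  pose proof (phi_neq_0 u v hu) as hphi.
  pose proof (radicand_pos' u v hu) as hW.
  unfold tchebychev_cov, sum_ix.
  rewrite metric_inv_uu, metric_inv_uv, metric_inv_vu, metric_inv_vv by exact hu.
  unfold darboux.
  rewrite ruled_vuv, ruled_vvu, ruled_vvv, dot_zero_r by exact hu.
  rewrite !(pd_congr a b _ _ _ u v hu metric_uv),
    !(pd_congr a b _ _ _ u v hu metric_vu),
    !(pd_congr a b _ _ (fun _ _ => 0) u v hu metric_vv).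
  rewrite pd_v_metric_uv by exact hu.
  rewrite !pd_const.
rewrite support_eq by exact hu.
  pose proof (support_value_pos alpha (de u) v).
  field; repeat split; try assumption; lra.
Qed.

Lemma tchebychev_u u v : I u -> tchebychev x y i1 u v =
  (1 - 4 * alpha) * support_value alpha (de u) v * v / (de u * w u v).
Proof.
  intros hu; pose proof (de_neq_0 a b s e hPhi u hu) as hd.
  pose proof (w_pos u v hu) as hw; pose proof (w_sqr u v hu) as hww.
  pose proof (support_value_pos alpha (de u) v) as hq.
  unfold tchebychev, sum_ix.
  rewrite metric_inv_uu, metric_inv_uv, tchebychev_cov_v by exact hu.
  unfold metric_factor; set (W := w u v) in *.
  set (q := support_value _ _ _) in *; rewrite <- hww; field; repeat split; lra.
Qed.

Lemma tchebychev_v u v : I u -> tchebychev x y i2 u v =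
  (4 * alpha - 1) * support_value alpha (de u) v *
  (Derive de u * (v ^ 2 - de u ^ 2) / 2 + h11_poly u v * v) / (de u ^ 2 * w u v).
Proof.
  intros hu; pose proof (de_neq_0 a b s e hPhi u hu) as hd.
  pose proof (w_pos u v hu) as hw; pose proof (w_sqr u v hu) as hww.
  pose proof (support_value_pos alpha (de u) v) as hq.
  unfold tchebychev, sum_ix.
  rewrite metric_inv_vu, metric_inv_vv, tchebychev_cov_u, tchebychev_cov_v by exact hu.
  unfold metric_factor; set (W := w u v) in *.
  set (q := support_value _ _ _) in *; rewrite <- hww; field; repeat split; lra.
Qed.

End Tchebychev.

(** * Divergence and rotation under conditions on the invariants *)

Section DivRot.
Context (a b : Rbar) (s e : R -> V3) (hPhi : skew_ruled_surface a b s e).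

Local Notation I := (in_interval a b).
Local Notation x := (ruled s e).
Local Notation de := (distribution_parameter s e).
Local Notation ka := (conical_curvature e).
Local Notation m := (striction_component s e).
Local Notation w u v := (sqrt (v ^ 2 + de u ^ 2)).
Local Notation T alpha := (tchebychev x (K_normalization x alpha)).

(** The support function is 1, so that w T^1 = v / delta and
    w T^2 = delta' (v^2 + delta^2) / (2 delta^2), and the two partial
    derivatives cancel. *)
Lemma divergence_conoid :
  (forall u, I u -> ka u = 0) -> (forall u, I u -> m u = 0) ->
  forall u v, I u -> divergence x (T 0) u v = 0.
Proof.
  intros hka hm u v hu; pose proof (de_neq_0 a b s e hPhi u hu) as hd.
  assert (support_1 : forall d r, support_value 0 d r = 1).
  { intros d r; unfold support_value, Rpower; rewrite Rmult_0_l; apply exp_0. }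
  unfold divergence, sum_ix.
  rewrite (pd_congr a b i1 _ (fun t r => r * / de t) u v hu).
  rewrite (pd_congr a b i2 _ (fun t r =>
    Derive de t / (2 * de t ^ 2) * (r * r + de t ^ 2)) u v hu).
  - assert (E1 : pd i1 (fun t r => r * / de t) u v = v * - (Derive de u / de u ^ 2)).
    { apply is_derive_unique, is_derive_scal.
      replace (- (Derive de u / de u ^ 2)) with (- Derive de u / de u ^ 2)
        by (field; exact hd).
      apply is_derive_inv; [now apply (de_derive a b s e hPhi) | exact hd]. }
    assert (E2 : pd i2 (fun t r => Derive de t / (2 * de t ^ 2) * (r * r + de t ^ 2)) u v
        = Derive de u / (2 * de u ^ 2) * (2 * v)).
    { apply is_derive_unique, is_derive_scal; auto_derive; [exact Logic.I | ring]. }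
    rewrite E1, E2; field; split; [exact hd|].
    rewrite (area_density_eq a b s e hPhi) by exact hu.
    pose proof (w_pos a b s e hPhi u v hu); lra.
  - intros t r ht; pose proof (w_pos a b s e hPhi t r ht).
    pose proof (de_neq_0 a b s e hPhi t ht).
    rewrite (area_density_eq a b s e hPhi), (tchebychev_v a b s e hPhi), support_1
      by exact ht.
    unfold h11_poly; rewrite hka, hm by exact ht; field; lra.
  - intros t r ht; pose proof (w_pos a b s e hPhi t r ht).
    pose proof (de_neq_0 a b s e hPhi t ht).
    rewrite (area_density_eq a b s e hPhi), (tchebychev_u a b s e hPhi), support_1
      by exact ht.
    field; lra.
Qed.

(** T^2 vanishes, while w T^1 depends on u through delta only. *)
Lemma divergence_helicoid alpha :
  (forall u, I u -> ka u = 0) -> (forall u, I u -> m u = 0) ->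
  (forall u, I u -> is_derive de u 0) ->
  forall u v, I u -> divergence x (T alpha) u v = 0.
Proof.
  intros hka hm hde u v hu.
  unfold divergence, sum_ix.
  rewrite (pd_congr a b i1 _ (fun _ r =>
    (1 - 4 * alpha) * support_value alpha (de u) r * r / de u) u v hu).
  rewrite (pd_congr a b i2 _ (fun _ _ => 0) u v hu).
  - rewrite pd_const.
    replace (pd i1 _ u v) with 0; [ring|].
    symmetry; exact (Derive_const _ u).
  - intros t r ht.
    rewrite (tchebychev_v a b s e hPhi), (is_derive_unique _ _ _ (hde t ht))
      by exact ht.
    unfold h11_poly.
    rewrite hka, hm, (is_derive_unique _ _ _ (hde t ht)) by exact ht.
    unfold Rdiv; ring.
  - intros t r ht; pose proof (w_pos a b s e hPhi t r ht).
    pose proof (de_neq_0 a b s e hPhi t ht).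
    rewrite (area_density_eq a b s e hPhi), (tchebychev_u a b s e hPhi) by exact ht.
    rewrite (derive_zero_constant a b de hde u t hu ht); field; lra.
Qed.

(** The covariant component along x_u has the factor delta + kappa delta lambda,
    hence vanishes, and the one along x_v depends on u through delta and kappa
    only. *)
Lemma rotation_edlinger alpha :
  (forall u, I u -> de u + ka u * m u = 0) ->
  (forall u, I u -> is_derive de u 0) -> (forall u, I u -> is_derive ka u 0) ->
  forall u v, I u -> rotation x (T alpha) u v = 0.
Proof.
  intros hm hde hka u v hu; unfold rotation, sum_ix.
  rewrite (pd_congr a b i1 _ (fun _ r =>
    (1 - 4 * alpha) * support_value alpha (de u) r * r * ka u * (r ^ 2 + de u ^ 2)
      / (de u ^ 2 * w u r)) u v hu).
  rewrite (pd_congr a b i2 _ (fun _ _ => 0) u v hu).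
  - rewrite pd_const.
    replace (pd i1 _ u v) with 0; [ring|].
    symmetry; exact (Derive_const _ u).
  - intros t r ht; pose proof (w_pos a b s e hPhi t r ht).
    pose proof (de_neq_0 a b s e hPhi t ht).
    rewrite (tchebychev_u a b s e hPhi), (tchebychev_v a b s e hPhi),
      (first_form_uu a b s e hPhi), (first_form_vu a b s e hPhi) by exact ht.
    unfold h11_poly; rewrite (is_derive_unique _ _ _ (hde t ht)).
    transitivity ((1 - 4 * alpha) * support_value alpha (de t) r * r
      * (r ^ 2 + de t ^ 2) * (de t + ka t * m t) / (de t ^ 2 * w t r)).
    + field; lra.
    + rewrite hm by exact ht; field; lra.
  - intros t r ht; pose proof (w_pos a b s e hPhi t r ht).
    pose proof (de_neq_0 a b s e hPhi t ht).
    rewrite (tchebychev_u a b s e hPhi), (tchebychev_v a b s e hPhi),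
      (first_form_uv a b s e hPhi), (first_form_vv a b s e hPhi) by exact ht.
    unfold h11_poly; rewrite (is_derive_unique _ _ _ (hde t ht)).
    rewrite (derive_zero_constant a b de hde u t hu ht).
    rewrite (derive_zero_constant a b ka hka u t hu ht).
    field; lra.
Qed.

End DivRot.

(** * Right conoids and right helicoids *)

Lemma v_is_derive_minus_const f (t : R) l (o : V3) :
  v_is_derive f t l -> v_is_derive (fun r => minus (f r) o) t l.
Proof.
  assert (D : forall g k c, is_derive g t k -> is_derive (fun r : R => g r - c) t k).
  { intros g k c hg; rewrite <- (Rminus_0_r k).
    apply (@is_derive_minus R_AbsRing R_NormedModule g (fun _ => c) t k 0 hg).
    apply (@is_derive_const R_AbsRing R_NormedModule). }
  intros (h1 & h2 & h3); split; [|split]; now apply D.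
Qed.

(** Differentiating f^2 = k gives 2 f f' = 0. *)
Lemma square_constant_derive a b (f : R -> R) k :
  (forall u, in_interval a b u -> is_derive f u (Derive f u)) ->
  (forall u, in_interval a b u -> f u <> 0) ->
  (forall u, in_interval a b u -> f u ^ 2 = k) ->
  forall u, in_interval a b u -> is_derive f u 0.
Proof.
  intros hd hn hk u hu; pose proof (hd u hu) as hf.
  assert (H : Derive f u * f u + f u * Derive f u = 0).
  { apply (is_derive_interval_unique a b (fun t => f t * f t) (fun _ => k) u); auto.
    - intros t ht; rewrite <- (hk t ht); ring.
    - now apply is_derive_Rmult.
    - apply (@is_derive_const R_AbsRing R_NormedModule). }
  assert (E : Derive f u = 0).
  { apply (Rmult_eq_reg_l (f u)); [lra | now apply hn]. }
  now rewrite <- E.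
Qed.

(** Where the line is not horizontal it crosses the heights 0 and +-h pi/2 over
    the axis; the crossings at +-h pi/2 have X = 0, hence so has the midpoint,
    which is the crossing at height 0 and has Y = 0. *)
Lemma slanted_line_in_helicoid h X0 Y0 Z0 E1 E2 E3 : h <> 0 -> E3 <> 0 ->
  (forall v, (X0 + v * E1) * sin ((Z0 + v * E3) / h)
             = (Y0 + v * E2) * cos ((Z0 + v * E3) / h)) ->
  X0 + - Z0 / E3 * E1 = 0 /\ Y0 + - Z0 / E3 * E2 = 0.
Proof.
  intros hh hE H.
  pose proof (H ((h * (PI / 2) - Z0) / E3)) as Hp.
  pose proof (H ((h * (- (PI / 2)) - Z0) / E3)) as Hm.
  pose proof (H (- Z0 / E3)) as H0.
  replace ((Z0 + (h * (PI / 2) - Z0) / E3 * E3) / h) with (PI / 2) in Hp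
    by (field; auto).
  replace ((Z0 + (h * (- (PI / 2)) - Z0) / E3 * E3) / h) with (- (PI / 2)) in Hm
    by (field; auto).
  replace ((Z0 + - Z0 / E3 * E3) / h) with 0 in H0 by (field; auto).
  rewrite sin_PI2, cos_PI2 in Hp.
  rewrite sin_neg, cos_neg, sin_PI2, cos_PI2 in Hm.
  rewrite sin_0, cos_0 in H0.
  split; [|lra].
  replace (X0 + - Z0 / E3 * E1) with
    (((X0 + (h * (PI / 2) - Z0) / E3 * E1)
      + (X0 + (h * (- (PI / 2)) - Z0) / E3 * E1)) / 2) by (field; auto).
  lra.
Qed.

Lemma parallel_to_unit X Y S C : S * S + C * C = 1 -> X * S = Y * C ->
  X = (X * C + Y * S) * C /\ Y = (X * C + Y * S) * S.
Proof.
  intros A B; split.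
  - transitivity (X * (S * S + C * C)); [rewrite A; ring|].
    transitivity (X * C * C + (X * S) * S); [ring | rewrite B; ring].
  - transitivity (Y * (S * S + C * C)); [rewrite A; ring|].
    transitivity (Y * S * S + (Y * C) * C); [ring | rewrite <- B; ring].
Qed.

Section Special.
Context (a b : Rbar) (s e : R -> V3) (hPhi : skew_ruled_surface a b s e).

Local Notation I := (in_interval a b).
Local Notation x := (ruled s e).
Local Notation n := (vDerive e).
Local Notation z := (frame_z e).
Local Notation de := (distribution_parameter s e).
Local Notation ka := (conical_curvature e).
Local Notation m := (striction_component s e).

Lemma orth_direction d : (forall u, I u -> dot (e u) d = 0) ->
  forall u, I u -> dot (n u) d = 0 /\ dot (vDerive n u) d = 0.
Proof.
  intros hd.
  assert (hn : forall u, I u -> dot (n u) d = 0).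
  { intros u hu; destruct (derive_e a b s e hPhi u hu) as (d1 & _ & _).
    pose proof (dot_constant_derive a b e (fun _ => d) u _ _ 0 hu hd d1
      (v_is_derive_const d u)) as H.
    rewrite dot_zero_r in H; lra. }
  intros u hu; split; [now apply hn|].
  destruct (derive_e a b s e hPhi u hu) as (_ & d2 & _).
  pose proof (dot_constant_derive a b n (fun _ => d) u _ _ 0 hu hn d2
    (v_is_derive_const d u)) as H.
  rewrite dot_zero_r in H; lra.
Qed.

Lemma orth_direction_z d : dot d d = 1 -> (forall u, I u -> dot (e u) d = 0) ->
  forall u, I u -> dot (z u) d ^ 2 = 1.
Proof.
  intros hdd hd u hu; destruct (orth_direction d hd u hu) as [hn _].
  rewrite (orthonormal_dot _ _ _ d d (frame_orthonormal a b s e hPhi u hu)) in hdd.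
  rewrite !(dot_comm d), hd, hn in hdd by exact hu; lra.
Qed.

(** A direction orthogonal to all rulings is parallel to z, so that e'' has no
    z-component and kappa = 0. With a point o of the axis, s - o is then
    orthogonal to n; differentiating this twice gives lambda = 0. *)
Lemma right_conoid_invariants : right_conoid a b s e ->
  (forall u, I u -> ka u = 0) /\ (forall u, I u -> m u = 0).
Proof.
  intros (o & d & hdd & H).
  assert (hd : forall u, I u -> dot (e u) d = 0) by (intros u hu; apply (H u hu)).
  assert (hka : forall u, I u -> ka u = 0).
  { intros u hu; destruct (orth_direction d hd u hu) as [hn he2].
    pose proof (orth_direction_z d hdd hd u hu) as hz.
    rewrite (orthonormal_dot _ _ _ _ d (frame_orthonormal a b s e hPhi u hu)) in he2.
    rewrite !(dot_comm d), hd, hn, e2_dot_z in he2 by exact hu.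
    assert (dot (z u) d <> 0) by (intros E; rewrite E in hz; lra).
    nra. }
  split; [exact hka|].
  assert (h1 : forall u, I u -> dot (minus (s u) o) (n u) = 0).
  { intros u hu; destruct (H u hu) as (_ & v & t & E).
    destruct (orth_direction d hd u hu) as [hn _].
    transitivity (dot (x u v) (n u) - v * dot (e u) (n u) - dot o (n u)).
    - unfold ruled; vring.
    - rewrite E, (ruling_orth_derive a b s e hPhi) by exact hu; dot_expand.
      rewrite (dot_comm d), hn; ring. }
  assert (h2 : forall u, I u -> dot (minus (s u) o) (e u) = 0).
  { intros u hu; destruct (derive_e a b s e hPhi u hu) as (_ & d2 & _).
    destruct (derive_s a b s e hPhi u hu) as (d1s & _ & _).
    pose proof (dot_constant_derive a b _ n u _ _ 0 hu h1
      (v_is_derive_minus_const _ _ _ o d1s) d2) as E.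
    rewrite (orthonormal_dot _ _ _ _ (vDerive n u)
      (frame_orthonormal a b s e hPhi u hu)) in E.
    rewrite (e2_dot_e a b s e hPhi), (e2_dot_n a b s e hPhi), e2_dot_z, hka in E
      by exact hu.
    rewrite (s1_dot_n a b s e hPhi) in E by exact hu; lra. }
  intros u hu; destruct (derive_e a b s e hPhi u hu) as (d1 & _ & _).
  destruct (derive_s a b s e hPhi u hu) as (d1s & _ & _).
  pose proof (dot_constant_derive a b _ e u _ _ 0 hu h2
    (v_is_derive_minus_const _ _ _ o d1s) d1) as E.
  cbv beta in E; rewrite h1 in E by exact hu; unfold striction_component; lra.
Qed.

(** A slanted ruling of a right helicoid passes through the point o of the axis.
    By continuity neighbouring rulings would do so as well, against
    injectivity. *)
Lemma helicoid_rulings_horizontal (o f1 f2 f3 : V3) h : orthonormal f1 f2 f3 -> h <> 0 ->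
  (forall u v, I u -> dot (minus (x u v) o) f1 * sin (dot (minus (x u v) o) f3 / h)
    = dot (minus (x u v) o) f2 * cos (dot (minus (x u v) o) f3 / h)) ->
  forall u, I u -> dot (e u) f3 = 0.
Proof.
  intros hf hh H.
  assert (through : forall u, I u -> dot (e u) f3 <> 0 -> exists v, x u v = o).
  { intros u hu hE.
    assert (coord : forall v f, dot (minus (x u v) o) f
      = dot (minus (s u) o) f + v * dot (e u) f) by (intros; unfold ruled; vring).
    destruct (slanted_line_in_helicoid h (dot (minus (s u) o) f1)
      (dot (minus (s u) o) f2) (dot (minus (s u) o) f3)
      (dot (e u) f1) (dot (e u) f2) (dot (e u) f3) hh hE) as [hX hY].
    { intros v; rewrite <- !coord; now apply H. }
    set (v := - dot (minus (s u) o) f3 / dot (e u) f3) in *.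
    assert (hZ : dot (minus (s u) o) f3 + v * dot (e u) f3 = 0)
      by (unfold v; field; exact hE).
    exists v; rewrite <- coord in hX, hY, hZ.
    pose proof (orthonormal_expand _ _ _ (minus (x u v) o) hf) as E.
    rewrite hX, hY, hZ in E.
    assert (Ez : minus (x u v) o = (0, 0, 0)) by (rewrite E; vring).
    pose proof (f_equal c1 Ez) as E1; pose proof (f_equal c2 Ez) as E2;
      pose proof (f_equal c3 Ez) as E3.
    rewrite c1_minus, c1_mk in E1; rewrite c2_minus, c2_mk in E2;
      rewrite c3_minus, c3_mk in E3.
    apply V3_ext; lra. }
  intros u hu.
  destruct (Req_dec (dot (e u) f3) 0) as [|hE]; [assumption|exfalso].
  assert (near : locally u (fun t => dot (e t) f3 <> 0 /\ I t)).
  { apply filter_and; [|now apply in_interval_locally].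
    destruct (derive_e a b s e hPhi u hu) as (d1 & _ & _).
    assert (hc : continuous (fun t => dot (e t) f3) u).
    { apply (ex_derive_continuous (fun t => dot (e t) f3)); eexists.
      apply (is_derive_dot e (fun _ => f3) u _ _ d1 (v_is_derive_const f3 u)). }
    exact (hc (fun r => r <> 0) (open_neq 0 _ hE)). }
  destruct near as [eps Heps].
  assert (hb : ball u eps (u + eps / 2)).
  { pose proof (cond_pos eps); apply Rabs_def1; unfold minus, plus, opp; simpl; lra. }
  destruct (Heps _ hb) as [hE' hu'].
  destruct (through u hu hE) as [v Ev].
  destruct (through _ hu' hE') as [v' Ev'].
  destruct (srs_injective _ _ _ _ hPhi u v (u + eps / 2) v' hu hu') as [E _].
  - congruence.
  - pose proof (cond_pos eps); lra.
Qed.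

(** The rulings are the horizontal generators of the helicoid, at the height
    h theta when they have the direction angle theta. So they meet the axis f3
    at right angles; as u is the arc length of the direction, theta' = +-1 and
    the component of s' along the axis, which is +-delta, is +-h. *)
Lemma on_right_helicoid_invariants : on_right_helicoid a b s e ->
  right_conoid a b s e /\ (forall u, I u -> is_derive de u 0).
Proof.
  intros (H & (o & f1 & f2 & f3 & h & hf & hh & HH) & Hon).
  assert (eqn : forall u v, I u ->
    dot (minus (x u v) o) f1 * sin (dot (minus (x u v) o) f3 / h)
    = dot (minus (x u v) o) f2 * cos (dot (minus (x u v) o) f3 / h)).
  { intros u v hu; destruct (proj1 (HH _) (Hon u v hu)) as (r & t & E).
    destruct hf as (h11 & h22 & h33 & h12 & h13 & h23).
    assert (D : forall f, dot (minus (x u v) o) f =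
      r * (cos t * dot f1 f + sin t * dot f2 f) + h * t * dot f3 f).
    { intros f; rewrite E; vring. }
    rewrite !D, (dot_comm f2 f1), (dot_comm f3 f1), (dot_comm f3 f2),
      h11, h22, h33, h12, h13, h23.
    replace ((r * (cos t * 0 + sin t * 0) + h * t * 1) / h) with t
      by (field; exact hh).
    ring. }
  pose proof (helicoid_rulings_horizontal o f1 f2 f3 h hf hh eqn) as hE.
  set (th := fun u => dot (minus (s u) o) f3 * / h).
  assert (lin : forall u v, I u ->
    (dot (minus (s u) o) f1 + v * dot (e u) f1) * sin (th u)
    = (dot (minus (s u) o) f2 + v * dot (e u) f2) * cos (th u)).
  { intros u v hu; pose proof (eqn u v hu) as E.
    assert (coord : forall f, dot (minus (x u v) o) f
      = dot (minus (s u) o) f + v * dot (e u) f) by (intros; unfold ruled; vring).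
    rewrite !coord, hE, Rmult_0_r, Rplus_0_r in E by exact hu; exact E. }
  assert (hX : forall u, I u -> dot (minus (s u) o) f1 * sin (th u)
    = dot (minus (s u) o) f2 * cos (th u)).
  { intros u hu; pose proof (lin u 0 hu); lra. }
  assert (hdir : forall u, I u -> dot (e u) f1 * sin (th u)
    = dot (e u) f2 * cos (th u)).
  { intros u hu; pose proof (lin u 1 hu); pose proof (hX u hu); nra. }
  assert (hcs : forall u, sin (th u) * sin (th u) + cos (th u) * cos (th u) = 1).
  { intros u; exact (sin2_cos2 (th u)). }
  (* The sign with which e is the direction of angle theta. *)
  set (sg := fun u => dot (e u) f1 * cos (th u) + dot (e u) f2 * sin (th u)).
  assert (hsg : forall u, I u -> sg u * sg u = 1).
  { intros u hu.
    pose proof (ruling_unit a b s e hPhi u hu) as hu1.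
    rewrite (orthonormal_dot _ _ _ _ _ hf), hE in hu1 by exact hu.
    pose proof (hcs u); pose proof (hdir u hu); unfold sg; nra. }
  assert (he1 : forall u, I u -> dot (e u) f1 = sg u * cos (th u))
    by (intros u hu; apply (parallel_to_unit _ _ _ _ (hcs u) (hdir u hu))).
  assert (he2 : forall u, I u -> dot (e u) f2 = sg u * sin (th u))
    by (intros u hu; apply (parallel_to_unit _ _ _ _ (hcs u) (hdir u hu))).
  assert (hcon : right_conoid a b s e).
  { exists o, f3; split; [apply hf|].
    intros u hu; split; [now apply hE|].
    set (rh := dot (minus (s u) o) f1 * cos (th u) + dot (minus (s u) o) f2 * sin (th u)).
    exists (- (sg u * rh)), (dot (minus (s u) o) f3).
    destruct (parallel_to_unit _ _ _ _ (hcs u) (hX u hu)) as [hs1 hs2].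
    fold rh in hs1, hs2.
    assert (E : minus (x u (- (sg u * rh))) o = scal (dot (minus (s u) o) f3) f3).
    { rewrite (orthonormal_expand _ _ _ (minus (x u (- (sg u * rh))) o) hf).
      assert (coord : forall v f, dot (minus (x u v) o) f
        = dot (minus (s u) o) f + v * dot (e u) f) by (intros; unfold ruled; vring).
      rewrite !coord, hE, hs1, hs2, he1, he2 by exact hu.
      replace (rh * cos (th u) + - (sg u * rh) * (sg u * cos (th u)))
        with (rh * cos (th u) * (1 - sg u * sg u)) by ring.
      replace (rh * sin (th u) + - (sg u * rh) * (sg u * sin (th u)))
        with (rh * sin (th u) * (1 - sg u * sg u)) by ring.
      rewrite hsg by exact hu; vring. }
    pose proof (f_equal c1 E) as E1; pose proof (f_equal c2 E) as E2;
      pose proof (f_equal c3 E) as E3.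
    rewrite c1_minus, c1_scal in E1; rewrite c2_minus, c2_scal in E2;
      rewrite c3_minus, c3_scal in E3.
    apply V3_ext; [rewrite c1_plus, c1_scal | rewrite c2_plus, c2_scal
                  | rewrite c3_plus, c3_scal]; lra. }
  split; [exact hcon|].
  destruct (right_conoid_invariants hcon) as [_ hm].
  apply (square_constant_derive a b de (h ^ 2)).
  - apply (de_derive a b s e hPhi).
  - apply (de_neq_0 a b s e hPhi).
  - intros u hu.
    destruct (derive_e a b s e hPhi u hu) as (d1 & d2 & _).
    destruct (derive_s a b s e hPhi u hu) as (d1s & _ & _).
    assert (hf33 : dot f3 f3 = 1) by apply hf.
    destruct (orth_direction f3 hE u hu) as [hn3 _].
    pose proof (orth_direction_z f3 hf33 hE u hu) as hz3.
    set (s13 := dot (vDerive s u) f3).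
    assert (hs13 : s13 ^ 2 = de u ^ 2).
    { unfold s13; rewrite (s1_expand a b s e hPhi), hm by exact hu; dot_expand.
      transitivity (de u ^ 2 * dot (z u) f3 ^ 2); [ring|]; rewrite hz3; ring. }
    assert (hth : is_derive th u (s13 * / h)).
    { unfold th.
      replace (s13 * / h) with ((dot (vDerive s u) f3 + dot (minus (s u) o) (0,0,0)) * / h
        + dot (minus (s u) o) f3 * 0) by (rewrite dot_zero_r; unfold s13; ring).
      apply (is_derive_Rmult (fun r => dot (minus (s r) o) f3) (fun _ => / h)).
      - apply (is_derive_dot (fun r => minus (s r) o) (fun _ => f3) u _ _
          (v_is_derive_minus_const _ _ _ o d1s) (v_is_derive_const f3 u)).
      - apply (@is_derive_const R_AbsRing R_NormedModule). }
    assert (dn : forall f, is_derive (fun t => dot (e t) f) u (dot (n u) f)).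
    { intros f; replace (dot (n u) f) with (dot (n u) f + dot (e u) (0,0,0))
        by (rewrite dot_zero_r; ring).
      exact (is_derive_dot e (fun _ => f) u _ _ d1 (v_is_derive_const f u)). }
    assert (dsin : is_derive (fun t => sin (th t)) u (s13 * / h * cos (th u))).
    { apply (is_derive_comp sin th u); [apply is_derive_sin | exact hth]. }
    assert (dcos : is_derive (fun t => cos (th t)) u (s13 * / h * - sin (th u))).
    { apply (is_derive_comp cos th u); [apply is_derive_cos | exact hth]. }
    pose proof (is_derive_interval_unique a b _ _ u _ _ hu hdir
      (is_derive_Rmult _ _ _ _ _ (dn f1) dsin)
      (is_derive_Rmult _ _ _ _ _ (dn f2) dcos)) as E.
    pose proof (ruling_orth_derive a b s e hPhi u hu) as hen.
    pose proof (ruling_derive_unit a b s e hPhi u hu) as hnn.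
    rewrite (orthonormal_dot _ _ _ _ _ hf), hn3 in hen.
    rewrite (orthonormal_dot _ _ _ _ _ hf), hn3 in hnn.
    cbv beta in E; rewrite he1, he2 in E by exact hu.
    rewrite he1, he2 in hen by exact hu.
    set (p := dot (n u) f1) in *; set (q := dot (n u) f2) in *.
    pose proof (hcs u) as A; pose proof (hsg u hu) as B.
    set (C := cos (th u)) in *; set (S := sin (th u)) in *.
    (* The derivative n of e is theta' sg times the unit vector at a right angle
       to the direction of angle theta. *)
    assert (E1 : s13 * / h * sg u = q * C - p * S).
    { transitivity (s13 * / h * sg u * (S * S + C * C)); [rewrite A; ring | lra]. }
    assert (E2 : p * C + q * S = 0).
    { transitivity ((sg u * sg u) * (p * C + q * S)); [rewrite B; ring|].
      transitivity (sg u * (sg u * C * p + sg u * S * q + dot (e u) f3 * 0)); [ring|].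
      rewrite hen; ring. }
    assert (E3 : (s13 * / h) ^ 2 = 1).
    { transitivity ((s13 * / h * sg u) ^ 2).
      - transitivity ((s13 * / h) ^ 2 * (sg u * sg u)); [rewrite B|]; ring.
      - rewrite E1.
        transitivity ((p * p + q * q + 0 * 0) * (S * S + C * C) - (p * C + q * S) ^ 2);
          [ring|].
        rewrite hnn, A, E2; ring. }
    rewrite <- hs13.
    transitivity ((s13 * / h) ^ 2 * h ^ 2); [field; exact hh | rewrite E3; ring].
Qed.

End Special.

(** * Osculating quadrics *)

Definition quad_sq (Q : quadpoly) : V3 := fst (fst (fst Q)).
Definition quad_mix (Q : quadpoly) : V3 := snd (fst (fst Q)).
Definition quad_lin (Q : quadpoly) : V3 := snd (fst Q).
Definition quad_cst (Q : quadpoly) : R := snd Q.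

Definition quad_polar (Q : quadpoly) (p q : V3) : R :=
  2 * (c1 (quad_sq Q) * (c1 p * c1 q) + c2 (quad_sq Q) * (c2 p * c2 q)
       + c3 (quad_sq Q) * (c3 p * c3 q))
  + (c1 (quad_mix Q) * (c2 p * c3 q + c3 p * c2 q)
     + c2 (quad_mix Q) * (c3 p * c1 q + c1 p * c3 q)
     + c3 (quad_mix Q) * (c1 p * c2 q + c2 p * c1 q)).

(** The directional derivative at p along q; it is affine in p, with linear part
    the polar form. *)
Definition quad_grad (Q : quadpoly) (p q : V3) : R :=
  quad_polar Q p q + (c1 (quad_lin Q) * c1 q + c2 (quad_lin Q) * c2 q
                      + c3 (quad_lin Q) * c3 q).

Lemma quad_evalE Q p : quad_eval Q p =
  / 2 * quad_polar Q p p + (c1 (quad_lin Q) * c1 p + c2 (quad_lin Q) * c2 p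
                      + c3 (quad_lin Q) * c3 p) + quad_cst Q.
Proof.
  destruct Q as [[[d k] l] c], p as [[p1 p2] p3].
  unfold quad_polar, quad_sq, quad_mix, quad_lin, quad_cst, quad_eval, dot, c1, c2, c3.
  simpl; field.
Qed.

Lemma quad_eval_plus Q (p q : V3) : quad_eval Q (plus p q) =
  quad_eval Q p + quad_grad Q p q + / 2 * quad_polar Q q q.
Proof. rewrite !quad_evalE; unfold quad_grad, quad_polar; to_coords; field. Qed.

Lemma quad_grad_plus_l Q (p q r : V3) :
  quad_grad Q (plus p q) r = quad_grad Q p r + quad_polar Q q r.
Proof. unfold quad_grad, quad_polar; to_coords; ring. Qed.

Lemma quad_grad_plus_r Q (p q r : V3) :
  quad_grad Q p (plus q r) = quad_grad Q p q + quad_grad Q p r.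
Proof. unfold quad_grad, quad_polar; to_coords; ring. Qed.

Lemma quad_grad_scal_r Q (p q : V3) k :
  quad_grad Q p (scal k q) = k * quad_grad Q p q.
Proof. unfold quad_grad, quad_polar; to_coords; ring. Qed.

Lemma quad_polar_comm Q p q : quad_polar Q p q = quad_polar Q q p.
Proof. unfold quad_polar; ring. Qed.

Lemma quad_polar_plus_l Q (p q r : V3) :
  quad_polar Q (plus p q) r = quad_polar Q p r + quad_polar Q q r.
Proof. unfold quad_polar; to_coords; ring. Qed.

Lemma quad_polar_plus_r Q (p q r : V3) :
  quad_polar Q p (plus q r) = quad_polar Q p q + quad_polar Q p r.
Proof. unfold quad_polar; to_coords; ring. Qed.

Lemma quad_polar_scal_l Q (p q : V3) k :
  quad_polar Q (scal k p) q = k * quad_polar Q p q.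
Proof. unfold quad_polar; to_coords; ring. Qed.

Lemma quad_polar_scal_r Q (p q : V3) k :
  quad_polar Q p (scal k q) = k * quad_polar Q p q.
Proof. unfold quad_polar; to_coords; ring. Qed.

Ltac quad_expand :=
  repeat first [ rewrite quad_polar_plus_l | rewrite quad_polar_plus_r
               | rewrite quad_polar_scal_l | rewrite quad_polar_scal_r
               | rewrite quad_grad_plus_l | rewrite quad_grad_plus_r
               | rewrite quad_grad_scal_r ].

Ltac quad_expand_in H :=
  repeat first [ rewrite quad_polar_plus_l in H | rewrite quad_polar_plus_r in H
               | rewrite quad_polar_scal_l in H | rewrite quad_polar_scal_r in H
               | rewrite quad_grad_plus_l in H | rewrite quad_grad_plus_r in H
               | rewrite quad_grad_scal_r in H ].

Ltac derive_polynomial :=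
  lazymatch goal with
  | |- is_derive (fun r => @?g r + @?h r) _ _ =>
      apply (is_derive_Rplus g h); derive_polynomial
  | |- is_derive (fun r => @?g r * @?h r) _ _ =>
      apply (is_derive_Rmult g h); derive_polynomial
  | |- is_derive (fun _ => ?k) _ _ =>
      apply (@is_derive_const R_AbsRing R_NormedModule)
  | |- _ => eassumption
  end.

Lemma is_derive_quad_eval Q f t f' : v_is_derive f t f' ->
  is_derive (fun r => quad_eval Q (f r)) t (quad_grad Q (f t) f').
Proof.
  intros (h1 & h2 & h3).
  apply (is_derive_ext (fun r => / 2 * quad_polar Q (f r) (f r)
    + (c1 (quad_lin Q) * c1 (f r) + c2 (quad_lin Q) * c2 (f r)
       + c3 (quad_lin Q) * c3 (f r)) + quad_cst Q)).
  { intros r; symmetry; apply quad_evalE. }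
  unfold quad_polar; evar (l : R); replace (quad_grad Q (f t) f') with l; subst l.
  - derive_polynomial.
  - unfold quad_grad, quad_polar, zero; simpl; field.
Qed.

Lemma is_derive_quad_grad Q f g t f' g' : v_is_derive f t f' -> v_is_derive g t g' ->
  is_derive (fun r => quad_grad Q (f r) (g r)) t
    (quad_polar Q f' (g t) + quad_grad Q (f t) g').
Proof.
  intros (h1 & h2 & h3) (k1 & k2 & k3).
  evar (l : R); replace (quad_polar Q f' (g t) + quad_grad Q (f t) g') with l; subst l.
  - unfold quad_grad, quad_polar; derive_polynomial.
  - unfold quad_grad, quad_polar, zero; simpl; ring.
Qed.

Definition v_continuous (f : R -> V3) (t : R) : Prop :=
  continuous (fun r => c1 (f r)) t /\ continuous (fun r => c2 (f r)) t /\
  continuous (fun r => c3 (f r)) t.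

Lemma v_is_derive_continuous f t l : v_is_derive f t l -> v_continuous f t.
Proof.
  intros (h1 & h2 & h3); split; [|split];
    apply (ex_derive_continuous (V := R_NormedModule)); eexists; eassumption.
Qed.

(** The common form of the derivatives of order 0, 1 and 2 of a quadratic
    polynomial along a curve; it is linear in the polynomial. *)
Definition quad_jet (k : R) (Q : quadpoly) (f g h : V3) : R :=
  quad_polar Q g g + quad_grad Q f h + k * quad_cst Q.

Lemma continuous_quad_jet k (f g h : R -> V3) Q u :
  v_continuous f u -> v_continuous g u -> v_continuous h u ->
  continuous (fun P : quadpoly * R =>
    quad_jet k (fst P) (f (snd P)) (g (snd P)) (h (snd P))) (Q, u).
Proof.
  intros (f1 & f2 & f3) (g1 & g2 & g3) (h1 & h2 & h3).
  assert (cv : forall l : R -> R, continuous l u ->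
    continuous (fun P : quadpoly * R => l (snd P)) (Q, u)).
  { intros l hl; apply continuous_comp; [apply continuous_snd | exact hl]. }
  assert (cf : forall (U : UniformSpace) (l : quadpoly -> U), continuous l Q ->
    continuous (fun P : quadpoly * R => l (fst P)) (Q, u)).
  { intros U l hl; apply continuous_comp; [apply continuous_fst | exact hl]. }
  assert (c1c : forall p : V3, continuous c1 p).
  { intros p; apply (continuous_comp fst fst); apply continuous_fst. }
  assert (c2c : forall p : V3, continuous c2 p).
  { intros p; apply (continuous_comp fst snd);
      [apply continuous_fst | apply continuous_snd]. }
  assert (c3c : forall p : V3, continuous c3 p) by (intros p; apply continuous_snd).
  assert (qs : continuous quad_sq Q).
  { apply (continuous_comp fst (fun P => fst (fst P))); [apply continuous_fst|].
    apply (continuous_comp fst fst); apply continuous_fst. }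
  assert (qm : continuous quad_mix Q).
  { apply (continuous_comp fst (fun P => snd (fst P))); [apply continuous_fst|].
    apply (continuous_comp fst snd); [apply continuous_fst | apply continuous_snd]. }
  assert (ql : continuous quad_lin Q).
  { apply (continuous_comp fst snd); [apply continuous_fst | apply continuous_snd]. }
  assert (comp : forall (l : quadpoly -> V3) (c : V3 -> R), continuous l Q ->
    (forall p, continuous c p) ->
    continuous (fun P : quadpoly * R => c (l (fst P))) (Q, u)).
  { intros l c hl hc; apply (cf R_UniformSpace (fun q => c (l q))).
    apply (continuous_comp l c); [exact hl | apply hc]. }
  assert (qc : continuous (fun P : quadpoly * R => quad_cst (fst P)) (Q, u)).
  { apply (cf R_UniformSpace quad_cst); clear.
    destruct Q as [Q c]; exact (continuous_snd Q c). }
  unfold quad_jet, quad_grad, quad_polar.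
  let rec go := lazymatch goal with
  | |- continuous (fun P => @?i P + @?l P) _ =>
      apply (@continuous_plus _ R_AbsRing R_NormedModule i l); go
  | |- continuous (fun P => @?i P * @?l P) _ =>
      apply (@continuous_mult _ R_AbsRing i l); go
  | |- continuous (fun P => ?c (?i (snd P))) _ =>
      apply (cv (fun r => c (i r))); assumption
  | |- continuous (fun P => ?c (?i (fst P))) _ => apply (comp i c); assumption
  | |- continuous (fun _ => ?j) _ => apply continuous_const
  | |- _ => assumption
  end in go.
Qed.

(** A linear condition that every quadric through three neighbouring rulings
    satisfies somewhere between them passes to the limit, because its left-hand
    side is jointly continuous in the quadric and the parameter. *)
Lemma osculating_limit a b s e u Q k (f g h : R -> V3) :
  in_interval a b u -> osculating_quadric a b s e u Q ->
  v_continuous f u -> v_continuous g u -> v_continuous h u ->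
  (forall Q' u2 u3, u < u2 < u3 -> in_interval a b u3 ->
    contains_ruling s e u Q' -> contains_ruling s e u2 Q' ->
    contains_ruling s e u3 Q' ->
    exists t, u <= t <= u3 /\ quad_jet k Q' (f t) (g t) (h t) = 0) ->
  quad_jet k Q (f u) (g u) (h u) = 0.
Proof.
  intros hu [_ hQ] hf hg hh H.
  destruct (Req_dec (quad_jet k Q (f u) (g u) (h u)) 0) as [|hn]; [assumption|exfalso].
  destruct (continuous_quad_jet k f g h Q u hf hg hh (fun r => r <> 0)
    (open_neq 0 _ hn)) as [eps Heps].
  destruct (hQ eps) as [eta Heta].
  destruct (in_interval_locally a b u hu) as [eps2 Heps2].
  set (d := Rmin eps (Rmin eta eps2) / 4).
  assert (hd : 0 < d /\ 4 * d <= eps /\ 4 * d <= eta /\ 4 * d <= eps2).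
  { pose proof (cond_pos eps); pose proof (cond_pos eta); pose proof (cond_pos eps2).
    pose proof (Rmin_l eps (Rmin eta eps2)); pose proof (Rmin_r eps (Rmin eta eps2)).
    pose proof (Rmin_l eta eps2); pose proof (Rmin_r eta eps2).
    assert (0 < Rmin eps (Rmin eta eps2)) by (repeat apply Rmin_glb_lt; assumption).
    unfold d; lra. }
  destruct hd as (hd & hd1 & hd2 & hd3).
  assert (hb : forall (r : posreal) t, u <= t <= u + 2 * d -> 4 * d <= r -> ball u r t).
  { intros r t ht hr; apply Rabs_def1; unfold minus, plus, opp; simpl; lra. }
  destruct (Heta u (u + d) (u + 2 * d)) as (Q' & _ & hQ' & r1 & r2 & r3);
    try (apply Heps2, hb; lra); try (apply hb; lra); try lra.
  destruct (H Q' (u + d) (u + 2 * d)) as (t & ht & E); try assumption;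
    [lra | apply Heps2, hb; lra |].
  apply (Heps (Q', t)); [split; [exact hQ' | now apply hb] | exact E].
Qed.

Lemma rolle (f f' : R -> R) p q : p < q ->
  (forall t, p <= t <= q -> is_derive f t (f' t)) -> f p = 0 -> f q = 0 ->
  exists t, p < t < q /\ f' t = 0.
Proof.
  intros hpq hd h1 h2.
  destruct (MVT_cor2 f f' p q hpq) as (t & E & ht).
  - intros t ht; apply is_derive_Reals; now apply hd.
  - exists t; split; [exact ht|].
    rewrite h1, h2 in E; nra.
Qed.

Lemma in_interval_mid a b u t u' : in_interval a b u -> in_interval a b u' ->
  u <= t <= u' -> in_interval a b t.
Proof.
  intros hu hu' ht; apply (in_interval_between a b u u' t hu hu').
  rewrite Rmin_left, Rmax_right by lra; exact ht.
Qed.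

Section Osculating.
Context (a b : Rbar) (s e : R -> V3) (hPhi : skew_ruled_surface a b s e).

Local Notation I := (in_interval a b).
Local Notation x := (ruled s e).
Local Notation n := (vDerive e).
Local Notation z := (frame_z e).
Local Notation de := (distribution_parameter s e).
Local Notation ka := (conical_curvature e).
Local Notation m := (striction_component s e).

(** An osculating quadric meets the surface to second order along the ruling,
    by Rolle's theorem for the quadrics through neighbouring rulings. *)
Lemma osculating_contact u Q v : I u -> osculating_quadric a b s e u Q ->
  let X := x u v in
  let X1 := plus (vDerive s u) (scal v (n u)) in
  let X2 := plus (vDerive (vDerive s) u) (scal v (vDerive n u)) in
  quad_eval Q X = 0 /\ quad_grad Q X X1 = 0 /\
  quad_polar Q X1 X1 + quad_grad Q X X2 = 0.
Proof.
  intros hu hQ.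
  set (X := fun t => x t v).
  set (X1 := fun t => plus (vDerive s t) (scal v (n t))).
  set (X2 := fun t => plus (vDerive (vDerive s) t) (scal v (vDerive n t))).
  assert (dX : forall t, I t -> v_is_derive X t (X1 t)).
  { intros t ht; apply v_is_derive_plus;
      [|apply v_is_derive_scal]; [apply (derive_s a b s e hPhi t ht)
      | apply (derive_e a b s e hPhi t ht)]. }
  assert (dX1 : forall t, I t -> v_is_derive X1 t (X2 t)).
  { intros t ht; apply v_is_derive_plus;
      [|apply v_is_derive_scal]; [apply (derive_s a b s e hPhi t ht)
      | apply (derive_e a b s e hPhi t ht)]. }
  assert (cX2 : v_continuous X2 u).
  { eapply v_is_derive_continuous, v_is_derive_plus;
      [|apply v_is_derive_scal]; [apply (derive_s a b s e hPhi u hu)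
      | apply (derive_e a b s e hPhi u hu)]. }
  pose proof (v_is_derive_continuous _ _ _ (dX u hu)) as cX.
  pose proof (v_is_derive_continuous _ _ _ (dX1 u hu)) as cX1.
  pose proof (v_is_derive_continuous _ _ _ (v_is_derive_const (0, 0, 0) u)) as c0.
  assert (rolle1 : forall Q' p q, I p -> I q -> p < q ->
    contains_ruling s e p Q' -> contains_ruling s e q Q' ->
    exists t, p < t < q /\ quad_grad Q' (X t) (X1 t) = 0).
  { intros Q' p q hp hq hpq h1 h2.
    apply (rolle (fun t => quad_eval Q' (X t))); [exact hpq| |apply h1|apply h2].
    intros t ht; apply is_derive_quad_eval, dX; now apply (in_interval_mid a b p t q). }
  split; [|split].
  - assert (E : forall P t, quad_eval P (X t)
      = quad_jet 1 P (scal (/ 2) (X t)) (0, 0, 0) (X t)).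
    { intros P t; rewrite quad_evalE; unfold quad_jet, quad_grad, quad_polar.
      to_coords; field. }
    change (x u v) with (X u); rewrite E.
    apply (osculating_limit a b s e u Q 1 (fun t => scal (/ 2) (X t))
      (fun _ => (0, 0, 0)) X hu hQ); try assumption.
    + eapply v_is_derive_continuous, v_is_derive_scal, dX; exact hu.
    + intros Q' u2 u3 h12 _ h1 _ _; exists u; split; [lra|].
      rewrite <- E; apply h1.
  - assert (E : forall P t, quad_grad P (X t) (X1 t)
      = quad_jet 0 P (X t) (0, 0, 0) (X1 t)).
    { intros P t; unfold quad_jet, quad_polar; to_coords; ring. }
    change (quad_grad Q (X u) (X1 u) = 0); rewrite E.
    apply (osculating_limit a b s e u Q 0 X (fun _ => (0, 0, 0)) X1 hu hQ);
      try assumption.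
    intros Q' u2 u3 h12 hu3 h1 h2 _.
    assert (hu2 : I u2) by (apply (in_interval_mid a b u u2 u3 hu hu3); lra).
    destruct (rolle1 Q' u u2) as (t & ht & Et); try assumption; [lra|].
    exists t; split; [lra|]; now rewrite <- E.
  - assert (E : forall P t, quad_polar P (X1 t) (X1 t) + quad_grad P (X t) (X2 t)
      = quad_jet 0 P (X t) (X1 t) (X2 t)) by (intros; unfold quad_jet; ring).
    change (quad_polar Q (X1 u) (X1 u) + quad_grad Q (X u) (X2 u) = 0); rewrite E.
    apply (osculating_limit a b s e u Q 0 X X1 X2 hu hQ); try assumption.
    intros Q' u2 u3 h12 hu3 h1 h2 h3.
    assert (hu2 : I u2) by (apply (in_interval_mid a b u u2 u3 hu hu3); lra).
    destruct (rolle1 Q' u u2) as (t1 & ht1 & E1); try assumption; [lra|].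
    destruct (rolle1 Q' u2 u3) as (t2 & ht2 & E2); try assumption; [lra|].
    destruct (rolle (fun t => quad_grad Q' (X t) (X1 t))
      (fun t => quad_polar Q' (X1 t) (X1 t) + quad_grad Q' (X t) (X2 t)) t1 t2)
      as (t & ht & Et); try assumption; [lra| |].
    + intros t ht.
      assert (hIt : I t) by (apply (in_interval_mid a b u t u3 hu hu3); lra).
      apply is_derive_quad_grad; [now apply dX | now apply dX1].
    + exists t; split; [lra|]; now rewrite <- E.
Qed.

(** Found by comparing coefficients of powers of v in the conditions of contact:
    up to the factor f, the equation of the quadric in the frame at s is
    - kappa Y^2 - (kappa + lambda) Z^2 - (delta' / delta) Y Z + 2 X Z
    - 2 delta Y = 0. *)
Lemma osculating_form u Q : I u -> osculating_quadric a b s e u Q ->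
  exists f,
    quad_eval Q (s u) = 0 /\ quad_grad Q (s u) (e u) = 0 /\
    quad_grad Q (s u) (n u) = - de u * f /\ quad_grad Q (s u) (z u) = 0 /\
    quad_polar Q (e u) (e u) = 0 /\ quad_polar Q (e u) (n u) = 0 /\
    quad_polar Q (e u) (z u) = f /\
    quad_polar Q (n u) (n u) = - ka u * f /\
    2 * de u * quad_polar Q (n u) (z u) = - Derive de u * f /\
    de u * quad_polar Q (z u) (z u) = - (m u + ka u * de u) * f.
Proof.
  intros hu hQ; pose proof (de_neq_0 a b s e hPhi u hu) as hd.
  exists (quad_polar Q (e u) (z u)).
  pose proof (fun v => osculating_contact u Q v hu hQ) as H; cbv zeta in H.
  assert (X2E : exists p, vDerive (vDerive s) u = plus (scal p (e u))
    (plus (scal (m u - ka u * de u) (n u)) (scal (Derive de u) (z u)))).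
  { exists (dot (vDerive (vDerive s) u) (e u)).
    rewrite (orthonormal_expand _ _ _ (vDerive (vDerive s) u)
      (frame_orthonormal a b s e hPhi u hu)) at 1.
    now rewrite (s2_dot_n a b s e hPhi), (s2_dot_z a b s e hPhi) by exact hu. }
  destruct X2E as [p X2E].
  assert (e2E : vDerive n u = plus (scal (- 1) (e u)) (scal (ka u) (z u))).
  { rewrite (orthonormal_expand _ _ _ (vDerive n u)
      (frame_orthonormal a b s e hPhi u hu)).
    rewrite (e2_dot_e a b s e hPhi), (e2_dot_n a b s e hPhi), e2_dot_z by exact hu.
    vring. }
  rewrite X2E, e2E, (s1_expand a b s e hPhi u hu) in H; unfold ruled in H.
  set (E := e u) in *; set (N := n u) in *; set (Z := z u) in *.
  set (B := quad_polar Q) in *; set (G := quad_grad Q (s u)) in *.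
  assert (H0 : forall v, quad_eval Q (s u) + v * G E + / 2 * v * v * B E E = 0).
  { intros v; destruct (H v) as [h _]; rewrite quad_eval_plus in h.
    quad_expand_in h; fold B G in h; rewrite <- h; ring. }
  assert (h0 : quad_eval Q (s u) = 0 /\ G E = 0 /\ B E E = 0).
  { pose proof (H0 0); pose proof (H0 1); pose proof (H0 (- 1)); lra. }
  destruct h0 as (hs & hGE & hEE).
  assert (H1 : forall v, de u * G Z + v * (G N + de u * B E Z) + v * v * B E N = 0).
  { intros v; destruct (H v) as (_ & h & _); unfold B, G in h; quad_expand_in h;
    fold B G in h.
    rewrite hGE, hEE in h; rewrite <- h; ring. }
  assert (h1 : de u * G Z = 0 /\ G N + de u * B E Z = 0 /\ B E N = 0).
  { pose proof (H1 0); pose proof (H1 1); pose proof (H1 (- 1)); lra. }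
  destruct h1 as (hGZ & hGN & hEN).
  assert (hGZ' : G Z = 0) by (destruct (Rmult_integral _ _ hGZ); [contradiction|assumption]).
  assert (H2 : forall v,
    de u * (de u * B Z Z + (m u + ka u * de u) * B E Z)
    + v * (2 * de u * B N Z + Derive de u * B E Z)
    + v * v * (B N N + ka u * B E Z) = 0).
  { intros v; destruct (H v) as (_ & _ & h); unfold B, G in h; quad_expand_in h;
    fold B G in h.
    assert (BC : forall k l, B k l = B l k) by (intros; apply quad_polar_comm).
    rewrite (BC N E), (BC Z E), (BC Z N) in h.
    rewrite hGE, hEE, hEN, hGZ' in h.
    replace (G N) with (- de u * B E Z) in h by lra.
    rewrite <- h; ring. }
  assert (h2 : de u * (de u * B Z Z + (m u + ka u * de u) * B E Z) = 0 /\
    2 * de u * B N Z + Derive de u * B E Z = 0 /\ B N N + ka u * B E Z = 0).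
  { pose proof (H2 0); pose proof (H2 1); pose proof (H2 (- 1)); lra. }
  destruct h2 as (hZZ & hNZ & hNN).
  assert (hZZ' : de u * B Z Z + (m u + ka u * de u) * B E Z = 0)
    by (destruct (Rmult_integral _ _ hZZ); [contradiction|assumption]).
  repeat split; lra.
Qed.

(** Without the factor f the quadric would be the whole space. *)
Lemma osculating_factor u Q o : I u -> osculating_quadric a b s e u Q ->
  quad_eval Q o <> 0 -> quad_polar Q (e u) (z u) <> 0.
Proof.
  intros hu hQ ho hf; apply ho.
  pose proof (de_neq_0 a b s e hPhi u hu) as hd.
  destruct (osculating_form u Q hu hQ)
    as (f & hs & hGE & hGN & hGZ & hEE & hEN & hEZ & hNN & hNZ & hZZ).
  assert (f = 0) by lra; subst f; rewrite hf, Rmult_0_r in *.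
  assert (hNZ' : quad_polar Q (n u) (z u) = 0) by nra.
  assert (hZZ' : quad_polar Q (z u) (z u) = 0) by nra.
  assert (Eo : o = plus (s u) (minus o (s u))) by vring.
  rewrite Eo, (orthonormal_expand _ _ _ (minus o (s u))
    (frame_orthonormal a b s e hPhi u hu)).
  rewrite quad_eval_plus; quad_expand.
  rewrite (quad_polar_comm Q (n u) (e u)), (quad_polar_comm Q (z u) (e u)),
    (quad_polar_comm Q (z u) (n u)).
  rewrite hs, hGE, hGN, hGZ, hEE, hEN, hf, hNN, hNZ', hZZ'; ring.
Qed.

End Osculating.

(** * Rotational hyperboloids *)

Definition hyperboloid_eq (r k sgn : R) (o f1 f2 f3 p : V3) : Prop :=
  (dot (minus p o) f1 ^ 2 + dot (minus p o) f2 ^ 2) / r ^ 2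
  - dot (minus p o) f3 ^ 2 / k ^ 2 = sgn.

(** [rotational_hyperboloid] with the semi-axes as parameters: the invariants of a
    congruence class. *)
Definition hyperboloid_of_shape (r k sgn : R) (H : V3 -> Prop) : Prop :=
  exists o f1 f2 f3 : V3, orthonormal f1 f2 f3 /\
    forall p, H p <-> hyperboloid_eq r k sgn o f1 f2 f3 p.

(** The image of a hyperboloid under the isometry has the image centre and
    axes, hence the same semi-axes. *)
Lemma congruent_shape r k sgn (A B : V3 -> Prop) :
  congruent A B -> hyperboloid_of_shape r k sgn A -> hyperboloid_of_shape r k sgn B.
Proof.
  intros (o & f1 & f2 & f3 & hf & HAB) (o' & g1 & g2 & g3 & hg & HA).
  set (L := fun p : V3 =>
    plus (scal (c1 p) f1) (plus (scal (c2 p) f2) (scal (c3 p) f3))).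
  assert (iso : forall p q, dot (L p) (L q) = dot p q).
  { intros p q; destruct hf as (h11 & h22 & h33 & h12 & h13 & h23).
    unfold L; dot_expand.
    rewrite (dot_comm f2 f1), (dot_comm f3 f1), (dot_comm f3 f2).
    rewrite h11, h22, h33, h12, h13, h23; unfold dot; ring. }
  exists (plus o (L o')), (L g1), (L g2), (L g3); split.
  { unfold orthonormal; rewrite !iso; exact hg. }
  intros q.
  set (p := (dot (minus q o) f1, dot (minus q o) f2, dot (minus q o) f3) : V3).
  assert (Eq : q = plus o (L p)).
  { assert (E : minus q o = L p) by exact (orthonormal_expand _ _ _ (minus q o) hf).
    pose proof (f_equal c1 E) as E1; pose proof (f_equal c2 E) as E2;
      pose proof (f_equal c3 E) as E3.
    rewrite c1_minus in E1; rewrite c2_minus in E2; rewrite c3_minus in E3.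
    apply V3_ext; [rewrite c1_plus, <- E1 | rewrite c2_plus, <- E2
                  | rewrite c3_plus, <- E3]; ring. }
  clearbody p.
  assert (D : forall g, dot (minus q (plus o (L o'))) (L g) = dot (minus p o') g).
  { intros g; rewrite <- (iso (minus p o') g); f_equal.
    rewrite Eq; unfold L; vring. }
  transitivity (A p).
  - rewrite Eq; symmetry; apply HAB.
  - rewrite HA; unfold hyperboloid_eq; rewrite !D; tauto.
Qed.

(** Reflecting a point of the hyperboloid in the coordinate planes isolates the
    coefficients of the odd monomials; the even ones follow. Pythagorean triples
    provide points with rational coordinates. *)
Lemma quadratic_on_unit_hyperboloid sgn q0 q1 q2 q3 q11 q22 q33 q12 q13 q23 :
  sgn = 1 \/ sgn = - 1 ->
  (forall X Y W, X ^ 2 + Y ^ 2 - W ^ 2 = sgn ->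
    q0 + q1 * X + q2 * Y + q3 * W + q11 * X ^ 2 + q22 * Y ^ 2 + q33 * W ^ 2
    + q12 * X * Y + q13 * X * W + q23 * Y * W = 0) ->
  q22 = q11 /\ q33 = - q11 /\ q12 = 0 /\ q13 = 0 /\ q23 = 0.
Proof.
  intros [-> | ->] H.
  - pose proof (H 1 0 0 ltac:(field)); pose proof (H (- 1) 0 0 ltac:(field)).
    pose proof (H 0 1 0 ltac:(field)); pose proof (H 0 (- 1) 0 ltac:(field)).
    pose proof (H (5 / 4) 0 (3 / 4) ltac:(field)).
    pose proof (H (5 / 4) 0 (- 3 / 4) ltac:(field)).
    pose proof (H (- 5 / 4) 0 (3 / 4) ltac:(field)).
    pose proof (H 0 (5 / 4) (3 / 4) ltac:(field)).
    pose proof (H 0 (5 / 4) (- 3 / 4) ltac:(field)).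
    pose proof (H (3 / 5) (4 / 5) 0 ltac:(field)).
    repeat split; lra.
  - pose proof (H 0 0 1 ltac:(field)); pose proof (H 0 0 (- 1) ltac:(field)).
    pose proof (H (3 / 4) 0 (5 / 4) ltac:(field)).
    pose proof (H (3 / 4) 0 (- 5 / 4) ltac:(field)).
    pose proof (H (- 3 / 4) 0 (5 / 4) ltac:(field)).
    pose proof (H 0 (3 / 4) (5 / 4) ltac:(field)).
    pose proof (H 0 (3 / 4) (- 5 / 4) ltac:(field)).
    pose proof (H 0 (- 3 / 4) (5 / 4) ltac:(field)).
    pose proof (H (9 / 20) (3 / 5) (5 / 4) ltac:(field)).
    repeat split; lra.
Qed.

(** The eigenvalues of the quadratic part are in the ratio 1 : 1 : - r^2 / k^2. *)
Lemma hyperboloid_polar r k sgn o f1 f2 f3 Q : 0 < r -> 0 < k ->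
  sgn = 1 \/ sgn = - 1 -> orthonormal f1 f2 f3 ->
  (forall p, hyperboloid_eq r k sgn o f1 f2 f3 p -> quad_eval Q p = 0) ->
  exists rho, forall p q, quad_polar Q p q =
    rho * dot p q - rho * (1 + r ^ 2 / k ^ 2) * (dot p f3 * dot q f3).
Proof.
  intros hr hk hsgn hf H.
  set (B := quad_polar Q).
  assert (HH : forall X Y W, X ^ 2 + Y ^ 2 - W ^ 2 = sgn ->
    quad_eval Q o + r * quad_grad Q o f1 * X + r * quad_grad Q o f2 * Y
    + k * quad_grad Q o f3 * W + / 2 * r ^ 2 * B f1 f1 * X ^ 2
    + / 2 * r ^ 2 * B f2 f2 * Y ^ 2 + / 2 * k ^ 2 * B f3 f3 * W ^ 2
    + r ^ 2 * B f1 f2 * X * Y + r * k * B f1 f3 * X * W + r * k * B f2 f3 * Y * W = 0).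
  { intros X Y W hXYW.
    set (y := plus (scal (r * X) f1) (plus (scal (r * Y) f2) (scal (k * W) f3))).
    assert (Ey : quad_eval Q (plus o y) = 0).
    { apply H; unfold hyperboloid_eq.
      assert (D : forall f, dot (minus (plus o y) o) f = dot y f) by (intros; vring).
      destruct hf as (h11 & h22 & h33 & h12 & h13 & h23).
      rewrite !D; unfold y; dot_expand.
      rewrite (dot_comm f2 f1), (dot_comm f3 f1), (dot_comm f3 f2),
        h11, h22, h33, h12, h13, h23.
      rewrite <- hXYW; field; lra. }
    rewrite quad_eval_plus in Ey; unfold y in Ey; quad_expand_in Ey.
    rewrite (quad_polar_comm Q f2 f1), (quad_polar_comm Q f3 f1),
      (quad_polar_comm Q f3 f2) in Ey.
    fold B in Ey; rewrite <- Ey; field. }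
  destruct (quadratic_on_unit_hyperboloid _ _ _ _ _ _ _ _ _ _ _ hsgn HH)
    as (E22 & E33 & E12 & E13 & E23).
  assert (hr2 : 0 < r ^ 2) by (apply pow_lt; exact hr).
  assert (hk2 : 0 < k ^ 2) by (apply pow_lt; exact hk).
  assert (B22 : B f2 f2 = B f1 f1).
  { apply (Rmult_eq_reg_l (r ^ 2)); lra. }
  assert (B33 : B f3 f3 = - B f1 f1 * (r ^ 2 / k ^ 2)).
  { apply (Rmult_eq_reg_l (k ^ 2)); [|lra].
    transitivity (- (r ^ 2 * B f1 f1)); [lra | field; lra]. }
  assert (B12 : B f1 f2 = 0).
  { apply (Rmult_eq_reg_l (r ^ 2)); lra. }
  assert (B13 : B f1 f3 = 0).
  { apply (Rmult_eq_reg_l (r * k)); [lra|]; apply Rmult_integral_contrapositive_currified; lra. }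
  assert (B23 : B f2 f3 = 0).
  { apply (Rmult_eq_reg_l (r * k)); [lra|]; apply Rmult_integral_contrapositive_currified; lra. }
  exists (B f1 f1); intros p q; fold B.
  rewrite (orthonormal_dot _ _ _ p q hf).
  rewrite (orthonormal_expand _ _ _ p hf) at 1; rewrite (orthonormal_expand _ _ _ q hf) at 1.
  unfold B; quad_expand.
  rewrite (quad_polar_comm Q f2 f1), (quad_polar_comm Q f3 f1), (quad_polar_comm Q f3 f2).
  fold B; rewrite B22, B33, B12, B13, B23; ring.
Qed.

(** * Edlinger surfaces *)

Section Edlinger.
Context (a b : Rbar) (s e : R -> V3) (hPhi : skew_ruled_surface a b s e).

Local Notation I := (in_interval a b).
Local Notation n := (vDerive e).
Local Notation z := (frame_z e).
Local Notation de := (distribution_parameter s e).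
Local Notation ka := (conical_curvature e).
Local Notation m := (striction_component s e).

(** Comparison of the two expressions for the quadratic part of the osculating
    quadric: the axis of rotation d has no n-component and is proportional to
    kappa e + z. *)
Lemma osculating_hyperboloid_invariants u Q r k sgn : I u ->
  osculating_quadric a b s e u Q -> 0 < r -> 0 < k -> sgn = 1 \/ sgn = - 1 ->
  hyperboloid_of_shape r k sgn (locus Q) ->
  Derive de u = 0 /\ de u + ka u * m u = 0 /\ ka u ^ 2 * (r ^ 2 / k ^ 2) = 1.
Proof.
  intros hu hQ hr hk hsgn (o & f1 & f2 & d & hf & HQ).
  assert (ho : quad_eval Q o <> 0).
  { intros Eo; pose proof (proj1 (HQ o) Eo) as E; unfold hyperboloid_eq in E.
    replace (minus o o) with ((0, 0, 0) : V3) in E by vring.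
    rewrite !(dot_comm (0, 0, 0)), !dot_zero_r in E.
    assert (sgn = 0) by (rewrite <- E; field; lra).
    destruct hsgn; lra. }
  pose proof (osculating_factor a b s e hPhi u Q o hu hQ ho) as hf0.
  destruct (hyperboloid_polar r k sgn o f1 f2 d Q hr hk hsgn hf) as (rho & HB).
  { intros p hp; exact (proj2 (HQ p) hp). }
  destruct (osculating_form a b s e hPhi u Q hu hQ)
    as (f & _ & _ & _ & _ & hEE & hEN & hEZ & hNN & hNZ & hZZ).
  rewrite hEZ in hf0.
  pose proof (frame_orthonormal a b s e hPhi u hu) as hfr.
  assert (hdd : dot d d = 1) by apply hf.
  rewrite (orthonormal_dot _ _ _ d d hfr), !(dot_comm d) in hdd.
  destruct hfr as (g11 & g22 & g33 & g12 & g13 & g23).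
  rewrite HB in hEE, hEN, hEZ, hNN, hNZ, hZZ.
  rewrite g11 in hEE; rewrite g12 in hEN; rewrite g13 in hEZ; rewrite g22 in hNN;
    rewrite g23 in hNZ; rewrite g33 in hZZ.
  assert (ht : 0 < r ^ 2 / k ^ 2) by (apply Rdiv_lt_0_compat; apply pow_lt; assumption).
  set (t := r ^ 2 / k ^ 2) in *.
  set (d1 := dot (e u) d) in *; set (d2 := dot (n u) d) in *; set (d3 := dot (z u) d) in *.
  set (D := de u) in *; set (K := ka u) in *; set (M := m u) in *.
  set (sig := rho * (1 + t)) in *.
  assert (hfE : f = - sig * d1 * d3) by lra.
  assert (hsig : sig <> 0) by (intros E; apply hf0; rewrite hfE, E; ring).
  assert (hd1 : d1 <> 0) by (intros E; apply hf0; rewrite hfE, E; ring).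
  assert (hd3 : d3 <> 0) by (intros E; apply hf0; rewrite hfE, E; ring).
  assert (hrho : rho = sig * d1 ^ 2) by lra.
  assert (hd2 : d2 = 0).
  { apply (Rmult_eq_reg_l (sig * d1)); [lra|].
    now apply Rmult_integral_contrapositive_currified. }
  rewrite hd2 in *.
  assert (hK : K * d3 = d1).
  { apply (Rmult_eq_reg_l (sig * d1));
      [|now apply Rmult_integral_contrapositive_currified].
    rewrite hfE in hNN; lra. }
  assert (hd1t : d1 ^ 2 * (1 + t) = 1).
  { apply (Rmult_eq_reg_l sig); [|exact hsig].
    transitivity (sig * d1 ^ 2 * (1 + t)); [ring|].
    rewrite <- hrho; unfold sig; ring. }
  repeat split.
  - apply (Rmult_eq_reg_r f); [lra | exact hf0].
  - apply (Rmult_eq_reg_l (sig * d3 ^ 2)); [|apply Rmult_integral_contrapositive_currified;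
      [exact hsig | now apply pow_nonzero]].
    rewrite hrho, hfE, <- hK in hZZ; lra.
  - apply (Rmult_eq_reg_l (d3 ^ 2)); [|now apply pow_nonzero].
    transitivity ((K * d3) ^ 2 * t); [ring|].
    rewrite hK; lra.
Qed.

(** The product of kappa^2 with the ratio of the squared semi-axes is 1, and
    congruent hyperboloids have the same ratio, so kappa^2 is constant. *)
Lemma edlinger_invariants : edlinger a b s e -> congruent_osculating_quadrics a b s e ->
  (forall u, I u -> de u + ka u * m u = 0) /\
  (forall u, I u -> is_derive de u 0) /\ (forall u, I u -> is_derive ka u 0).
Proof.
  intros hE hC.
  assert (H : forall u, I u -> Derive de u = 0 /\ de u + ka u * m u = 0 /\
    forall u', I u' -> ka u' ^ 2 = ka u ^ 2).
  { intros u hu.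
    destruct (hE u hu) as (Q & hQ & o & f1 & f2 & f3 & r & k & sgn & hf & hr & hk & hs & HQ).
    assert (sh : hyperboloid_of_shape r k sgn (locus Q))
      by (exists o, f1, f2, f3; split; [exact hf | exact HQ]).
    destruct (osculating_hyperboloid_invariants u Q r k sgn hu hQ hr hk hs sh)
      as (h1 & h2 & h3).
    split; [exact h1 | split; [exact h2|]].
    intros u' hu'; destruct (hE u' hu') as (Q' & hQ' & _).
    destruct (osculating_hyperboloid_invariants u' Q' r k sgn hu' hQ' hr hk hs)
      as (_ & _ & h3').
    - exact (congruent_shape r k sgn _ _ (hC u u' Q Q' hu hu' hQ hQ') sh).
    - assert (ht : r ^ 2 / k ^ 2 <> 0).
      { intros E; rewrite E in h3; lra. }
      apply (Rmult_eq_reg_r (r ^ 2 / k ^ 2)); [congruence | exact ht]. }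
  split; [|split].
  - intros u hu; apply (H u hu).
  - intros u hu; destruct (H u hu) as (h & _); rewrite <- h.
    now apply (de_derive a b s e hPhi).
  - intros u hu; apply (square_constant_derive a b ka (ka u ^ 2)).
    + apply (ka_derive a b s e hPhi).
    + intros t ht E; destruct (H t ht) as (_ & h & _).
      apply (de_neq_0 a b s e hPhi t ht); rewrite E in h; lra.
    + intros t ht; now apply (H u hu).
    + exact hu.
Qed.

End Edlinger.

(** * Vanishing of the divergence and of the rotation *)

Theorem proposition5 (a b : Rbar) (s e : R -> V3)
    (hPhi : skew_ruled_surface a b s e) :
  let x := ruled s e in
  let T alpha := tchebychev x (K_normalization x alpha) in
  (right_conoid a b s e ->
     forall u v, in_interval a b u -> divergence x (T 0) u v = 0) /\
  (on_right_helicoid a b s e ->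
     forall alpha, alpha <> 0 -> alpha <> 1 / 4 ->
     forall u v, in_interval a b u -> divergence x (T alpha) u v = 0) /\
  (edlinger a b s e -> congruent_osculating_quadrics a b s e ->
     forall alpha, alpha <> 1 / 4 ->
     forall u v, in_interval a b u -> rotation x (T alpha) u v = 0).
Proof.
  intros x T; split; [|split].
  - intros hcon; destruct (right_conoid_invariants a b s e hPhi hcon) as [hka hm].
    exact (divergence_conoid a b s e hPhi hka hm).
  - intros hhel alpha _ _.
    destruct (on_right_helicoid_invariants a b s e hPhi hhel) as [hcon hde].
    destruct (right_conoid_invariants a b s e hPhi hcon) as [hka hm].
    exact (divergence_helicoid a b s e hPhi alpha hka hm hde).
  - intros hE hC alpha _.
    destruct (edlinger_invariants a b s e hPhi hE hC) as (hm & hde & hka).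
    exact (rotation_edlinger a b s e hPhi alpha hm hde hka).
Qed.
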